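(* Let $\alpha>0$. For any bounded harmonic function $\phi\in L^\infty(\mathbb{C})$, the H-Toeplitz operator $S_\phi$ is Hilbert-Schmidt on the Fock space $F_\alpha^2$ if and only if $\phi\equiv 0$.
   Context: For $\alpha>0$ let $d\lambda_\alpha(z)=\frac{\alpha}{\pi}e^{-\alpha|z|^2}\,dA(z)$ on $\mathbb{C}$ ($dA$ is Lebesgue area measure). The Fock space $F_\alpha^2$ is the Hilbert space of entire functions in $L^2(\mathbb{C},d\lambda_\alpha)$, with the $L^2$ inner product and orthonormal basis $e_n(z)=\sqrt{\alpha^n/n!}\,z^n$, $n\ge 0$. $P:L^2(\mathbb{C},d\lambda_\alpha)\to F_\alpha^2$ is the orthogonal projection. The dilation operator $K:F_\alpha^2\to L^2(\mathbb{C},d\lambda_\alpha)$ is the bounded linear operator determined by $K(e_{2n})=e_n$ and $K(e_{2n+1})=\overline{e_{n+1}}$ for $n\ge 0$. For $\phi\in L^\infty(\mathbb{C})$ the H-Toeplitz operator $S_\phi:F_\alpha^2\to F_\alpha^2$ is $S_\phi f=P(\phi\cdot Kf)$. *)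

(* Defs.v *)
From HB Require Import structures.
From mathcomp Require Import all_boot all_order all_algebra.
From mathcomp Require Import all_classical all_reals all_analysis.
From mathcomp Require Export complex.
Import Order.TTheory GRing.Theory Num.Theory.
Import numFieldNormedType.Exports.

Set Implicit Arguments.
Unset Strict Implicit.
Unset Printing Implicit Defensive.

Local Open Scope classical_set_scope.
Local Open Scope ring_scope.
Local Open Scope complex_scope.

(* Functions C -> C are handled as representatives: operators act on actual
   functions, and identities between elements of L^2 are stated almost
   everywhere.  C = R[i] has no measurable structure, so integrals over C are
   integrals over R * R along (x, y) |-> x + iy. *)

Section FockSpace.
Variable R : realType.
Implicit Types (alpha : R) (f g h phi : R[i] -> R[i]) (p : R * R).

Definition cxy p : R[i] := p.1 +i* p.2.

Local Notation area := (@lebesgue_measure R \x @lebesgue_measure R)%E.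
Local Notation normc := ComplexField.Normc.normc.

Definition gauss_weight alpha (z : R[i]) : R :=
  alpha / pi * expR (- alpha * normc z ^+ 2).

(* Borel measurability; every class of L^2 has a Borel representative. *)
Definition cmeasurable f : Prop :=
  measurable_fun [set: measurableTypeR R * measurableTypeR R]
    (fun p => complex.Re (f (cxy p)) : measurableTypeR R) /\
  measurable_fun [set: measurableTypeR R * measurableTypeR R]
    (fun p => complex.Im (f (cxy p)) : measurableTypeR R).

(* The weight is positive, so almost everywhere means the same for the area
   measure as for the Gaussian measure. *)
Definition ae_equal f g : Prop :=
  {ae area, forall p, f (cxy p) = g (cxy p)}.

Definition sqnorm alpha f : \bar R :=
  \int[area]_p
    (normc (f (cxy p)) ^+ 2 * gauss_weight alpha (cxy p))%:E.

Definition inner alpha f g : R[i] :=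
  (\int[area]_p (complex.Re (f (cxy p) * (g (cxy p))^*)
                 * gauss_weight alpha (cxy p)))%R +i*
  (\int[area]_p (complex.Im (f (cxy p) * (g (cxy p))^*)
                 * gauss_weight alpha (cxy p)))%R.

Definition L2 alpha : set (R[i] -> R[i]) :=
  [set f | cmeasurable f /\ (sqnorm alpha f < +oo)%E].

(* derivable over the base field R[i]: complex differentiability. *)
Definition entire f : Prop :=
  forall z : R[i]^o, derivable (f : R[i]^o -> R[i]^o) z 1.

Definition fock alpha : set (R[i] -> R[i]) := [set f | entire f /\ L2 alpha f].

Definition fock_monomial alpha (n : nat) : R[i] -> R[i] :=
  fun z => (Num.sqrt (alpha ^+ n / n`!%:R))%:C * z ^+ n.

Definition fock_projection alpha (P : (R[i] -> R[i]) -> R[i] -> R[i]) : Prop :=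
  forall g, L2 alpha g -> fock alpha (P g) /\
    (forall h, fock alpha h -> inner alpha (fun z => g z - P g z) h = 0).

(* K f is a representative of the value at f of the dilation operator; these
   conditions determine its class, as linear combinations of the monomials
   are dense in the Fock space. *)
Definition dilation alpha (K : (R[i] -> R[i]) -> R[i] -> R[i]) : Prop :=
  [/\ forall f, fock alpha f -> L2 alpha (K f),
      forall (a : R[i]) f g, fock alpha f -> fock alpha g ->
        ae_equal (K (fun z => a * f z + g z)) (fun z => a * K f z + K g z),
      exists M : R, forall f, fock alpha f ->
        (sqnorm alpha (K f) <= (M ^+ 2)%:E * sqnorm alpha f)%E,
      forall n, ae_equal (K (fock_monomial alpha n.*2)) (fock_monomial alpha n)
    & forall n, ae_equal (K (fock_monomial alpha n.*2.+1))
                         (fun z => (fock_monomial alpha n.+1 z)^*)].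

Definition h_toeplitz (K P : (R[i] -> R[i]) -> R[i] -> R[i]) phi :
    (R[i] -> R[i]) -> R[i] -> R[i] :=
  fun f => P (fun z => phi z * K f z).

(* An orthonormal basis of a Hilbert space is a maximal orthonormal set.
   Elements of the Fock space are continuous, hence f = 0 pointwise. *)
Definition fock_orthonormal_basis alpha (B : set (R[i] -> R[i])) : Prop :=
  [/\ B `<=` fock alpha,
      forall b c, B b -> B c -> inner alpha b c = (b == c)%:R
    & forall f, fock alpha f -> (forall b, B b -> inner alpha f b = 0) ->
        f = (fun=> 0)].

(* For a bounded linear T the sum does not depend on the orthonormal basis. *)
Definition hilbert_schmidt alpha (T : (R[i] -> R[i]) -> R[i] -> R[i]) : Prop :=
  exists2 B, fock_orthonormal_basis alpha B &
    (\esum_(b in B) sqnorm alpha (T b) < +oo)%E.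

Definition dx (u : R * R -> R) : R * R -> R := fun p => 'D_(1 : R, 0 : R) u p.
Definition dy (u : R * R -> R) : R * R -> R := fun p => 'D_(0 : R, 1 : R) u p.

(* Class C^n through iterated partial derivatives, mixed ones included. *)
Fixpoint Cn (n : nat) (u : R * R -> R) : Prop :=
  if n is m.+1 then
    [/\ continuous u,
        forall p, derivable u p (1 : R, 0 : R) /\ derivable u p (0 : R, 1 : R),
        Cn m (dx u) & Cn m (dy u)]
  else continuous u.

Definition real_harmonic (u : R * R -> R) : Prop :=
  Cn 2 u /\ forall p, dx (dx u) p + dy (dy u) p = 0.

(* phi is complex-valued; the Laplacian acts on real and imaginary parts. *)
Definition harmonic_on_C phi : Prop :=
  real_harmonic (fun p => complex.Re (phi (cxy p))) /\
  real_harmonic (fun p => complex.Im (phi (cxy p))).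

Definition bounded_on_C phi : Prop :=
  exists M : R, forall z, normc (phi z) <= M.

End FockSpace.

(* Main.v *)
Require Import Defs.
From mathcomp Require Import all_boot all_order all_algebra.
From mathcomp Require Import all_classical all_reals all_analysis complex.
From mathcomp Require Import measurable_realfun ring lra.
Import Order.TTheory GRing.Theory Num.Theory.
Import numFieldNormedType.Exports.

(* A bounded harmonic function on the plane is a constant [c]: the barrier
   [ln s - 1 / s], with [s] the squared distance to a point [a], is strictly
   superharmonic and tends to [+oo], so the maximum principle outside a small
   disc around [a] gives [u z <= u a] for all [z] and [a].
   The operator is then [c P K], which sends [e_{2m}] to [c e_m].  For an
   orthonormal basis [B], each [e_{2m}] is the limit of its Fourier sums, so
   that the functionals [l_m f = <c K f, e_m>], for which [l_m e_{2m} = c],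
   satisfy [sum_b |l_m b|^2 >= |c|^2 / 4].  Summing over [m < N], Bessel's
   inequality [sum_m |l_m b|^2 <= |P (c K b)|^2] bounds [N |c|^2 / 4] by the
   Hilbert-Schmidt sum, whence [c = 0].
   Convergence of Fourier sums needs completeness: Riesz-Fischer for the
   Gaussian [L^2], together with the projection [P], which shows that the Fock
   space is closed without any appeal to Cauchy's integral formula. *)

Set Implicit Arguments.
Unset Strict Implicit.
Unset Printing Implicit Defensive.

Local Open Scope classical_set_scope.
Local Open Scope ring_scope.

(** * Liouville's theorem for bounded harmonic functions *)

(** The Hilbert-Schmidt condition names one arbitrary basis [B] whose relation to the monomials is
    unknown, so the sum cannot be evaluated on the [e_{2m}] themselves. For [c = 1] the sum over [b]
    of [|l_m b|^2] is the squared norm of the image of [e_m] under the adjoint of [K], hence at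
    least 1. The constant 1/4 is what remains when adjoints and infinite expansions are avoided: at
    most half of the pairing [<K e_{2m}, e_m> = 1] is lost in truncating the Fourier sum, and
    [x y <= x^2 / 4 + y^2] together with Bessel's inequality costs another quarter. A maximal
    orthonormal set comes without an enumeration, so Fourier sums run over finite subsets of [B]
    whose coefficient sums approach their supremum. The orthonormality of the monomials rests on
    integration by parts in Cartesian coordinates, which reduces every integral to one-dimensional
    Gaussian moments; polar coordinates do not occur. *)

Lemma second_derive_at_max (R : realType) (g g1 : R -> R) (g2 d : R) :
  0 < d -> (forall t : R, `|t| < d -> is_derive t 1 g (g1 t)) ->
  is_derive (0 : R) 1 g1 g2 -> (forall t, `|t| < d -> g t <= g 0) -> g2 <= 0.
Proof.
move=> d0 dg dg1 gmax; rewrite leNgt; apply/negP => g2_gt0.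
have absd t : t \in `](- d), d[%R -> `|t| < d by rewrite in_itv /= ltr_norml.
have g10 : g1 0 = 0.
  have d0' : is_derive (0 : R) 1 g 0.
    apply: (@derive1_at_max _ g (- d) d); first by lra.
    - by move=> t /absd /dg[].
    - by rewrite in_itv /=; lra.
    - by move=> t /absd; exact: gmax.
  have d1 : is_derive (0 : R) 1 g (g1 0) by apply: dg; rewrite normr0.
  by rewrite -(@derive_val _ _ _ _ _ _ _ d1) (@derive_val _ _ _ _ _ _ _ d0').
have cv : (fun h : R => h^-1 *: ((g1 \o shift 0) (h *: 1) - g1 0)) @ 0^' --> g2.
  by case: dg1 => dv <-; exact: dv.
have /cv : nbhs g2 [set y : R | 0 < y] by exact: lt_nbhsr.
case=> e /= e0 He.
(* [He] makes the quotient [(g1 h - g1 0) / h] positive for [0 < |h| < e], so [g1 > 0] on []0, b]]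
   and the mean value theorem gives [g b > g 0]. *)
pose b := Num.min (d / 2) (e / 2).
have b0 : 0 < b by rewrite lt_min !divr_gt0.
have bd : b < d by rewrite gt_min; apply/orP; left; lra.
have be : b < e by rewrite gt_min; apply/orP; right; lra.
have dgin (t : R) : 0 <= t <= b -> `|t| < d.
  by case/andP => t0 tb; rewrite ger0_norm//; lra.
have [c cb eqc] : exists2 c, c \in `]0, b[%R & g b - g 0 = g1 c * (b - 0).
  apply: MVT => //.
    by move=> x; rewrite in_itv /= => /andP[x0 xb]; apply: dg; apply: dgin; lra.
  apply: derivable_within_continuous => x; rewrite in_itv /= => /dgin /dg[] //.
move: cb; rewrite in_itv /= => /andP[c0 cb].
have := He c; rewrite /ball_ /= sub0r normrN gtr0_norm// => /(_ (lt_trans cb be)).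
rewrite gt_eqF// g10 subr0 addr0 => /(_ isT).
rewrite [_%:A]mulr1 pmulr_rgt0 ?invr_gt0// => g1c.
have := gmax b (dgin b _); rewrite lexx ltW// => /(_ isT).
have : 0 < g1 c * b by rewrite mulr_gt0.
by rewrite subr0 in eqc; lra.
Qed.

(** The two difference quotients are the same function of [h], so partial derivatives become
    ordinary derivatives along a line. *)
Lemma is_derive_along (R : realType) (u : R * R -> R) (p v : R * R) (t : R) :
  derivable u (p + t *: v) v ->
  is_derive t (1 : R) (fun s => u (p + s *: v)) ('D_v u (p + t *: v)).
Proof.
have E : (fun h : R => h^-1 *: (((fun s => u (p + s *: v)) \o shift t) (h *: 1)
       - u (p + t *: v))) =
   (fun h : R => h^-1 *: ((u \o shift (p + t *: v)) (h *: v) - u (p + t *: v))).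
  apply/funext => h /=; congr (_ *: (u _ - _)).
  by rewrite [h *: 1]mulr1 scalerDl addrCA.
by move=> du; split; rewrite /derivable /derive E.
Qed.

Lemma derive_log_barrier (R : realType) (x y t : R) :
  (x + t) ^+ 2 + y ^+ 2 > 0 ->
  is_derive t 1 (fun t => ln ((x + t) ^+ 2 + y ^+ 2) - ((x + t) ^+ 2 + y ^+ 2)^-1)
    (2 * (x + t) * (((x + t) ^+ 2 + y ^+ 2)^-1 + ((x + t) ^+ 2 + y ^+ 2) ^- 2)).
Proof.
move=> s0.
have ds : is_derive t 1 (fun t => (x + t) ^+ 2 + y ^+ 2) (2 * (x + t)).
  by apply: is_derive_eq; rewrite /GRing.scale /=; ring.
have dl := @is_derive1_ln _ _ s0.
have d1 : is_derive t 1 (fun t => ln ((x + t) ^+ 2 + y ^+ 2))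
   (((x + t) ^+ 2 + y ^+ 2)^-1 * (2 * (x + t))).
  exact: (@is_derive1_comp _ _ (fun t => (x + t) ^+ 2 + y ^+ 2)).
have d2 : is_derive t 1 (fun t => ((x + t) ^+ 2 + y ^+ 2)^-1)
   (- ((x + t) ^+ 2 + y ^+ 2) ^- 2 *: (2 * (x + t))).
  by apply: is_deriveV; rewrite gt_eqF.
apply: is_derive_eq; rewrite /GRing.scale /=; ring.
Qed.

Lemma derive2_log_barrier (R : realType) (x y : R) :
  x ^+ 2 + y ^+ 2 > 0 ->
  is_derive (0 : R) 1
   (fun t => 2 * (x + t) * (((x + t) ^+ 2 + y ^+ 2)^-1 + ((x + t) ^+ 2 + y ^+ 2) ^- 2))
   (2 * ((x ^+ 2 + y ^+ 2)^-1 + (x ^+ 2 + y ^+ 2) ^- 2)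
    - 4 * x ^+ 2 * ((x ^+ 2 + y ^+ 2) ^- 2 + 2 * (x ^+ 2 + y ^+ 2) ^- 3)).
Proof.
move=> s0.
have ds : is_derive (0:R) 1 (fun t => (x + t) ^+ 2 + y ^+ 2) (2 * x).
  by apply: is_derive_eq; rewrite /GRing.scale /=; ring.
have d2 : is_derive (0:R) 1 (fun t => ((x + t) ^+ 2 + y ^+ 2)^-1)
   (- (x ^+ 2 + y ^+ 2) ^- 2 *: (2 * x)).
  rewrite -[X in (X ^+ 2 + _) ^- 2](addr0 x).
  by apply: is_deriveV; rewrite addr0 gt_eqF.
have d3 : is_derive (0:R) 1 (fun t => ((x + t) ^+ 2 + y ^+ 2) ^- 2)
   (2 * (x ^+ 2 + y ^+ 2)^-1 * (- (x ^+ 2 + y ^+ 2) ^- 2 *: (2 * x))).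
  rewrite (_ : (fun t => _) = (fun t => ((x + t) ^+ 2 + y ^+ 2)^-1) ^+ 2); last first.
    by apply/funext => t; rewrite exprfctE exprVn.
  by apply: is_derive_eq; rewrite /= addr0 /GRing.scale /=; ring.
apply: is_derive_eq; rewrite /GRing.scale /= !addr0.
by field; rewrite gt_eqF.
Qed.

Definition sqdist (R : realType) (a p : R * R) : R :=
  (p.1 - a.1) ^+ 2 + (p.2 - a.2) ^+ 2.

(** For [s] a squared distance, [ln s] is harmonic away from the centre and grows to infinity; the
    term [- s^-1] makes the Laplacian strictly negative without spoiling the growth, so that the
    second derivative test gives a contradiction. *)
Definition log_barrier (R : realType) (s : R) : R := ln s - s^-1.

Lemma sqdist_ge0 (R : realType) (a p : R * R) : 0 <= sqdist a p.
Proof. by rewrite addr_ge0 ?sqr_ge0. Qed.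

Lemma continuous_sqdist (R : realType) (a : R * R) : continuous (sqdist a).
Proof.
move=> p.
have sub_sqr (c : R) : continuous (fun x : R => (x - c) ^+ 2).
  move=> x; apply: (@continuous_comp _ _ _ (fun x => x - c) (fun y => y ^+ 2)).
    by apply: cvgB; [exact: cvg_id|exact: cvg_cst].
  exact: exprn_continuous.
apply: cvgD.
- apply: (@continuous_comp _ _ _ fst (fun x : R => (x - a.1) ^+ 2)).
    exact: cvg_fst.
  exact: sub_sqr.
- apply: (@continuous_comp _ _ _ snd (fun x : R => (x - a.2) ^+ 2)).
    exact: cvg_snd.
  exact: sub_sqr.
Qed.

Lemma continuous_log_barrier (R : realType) (s : R) :
  0 < s -> {for s, continuous (@log_barrier R)}.
Proof.
move=> s0; apply: cvgB; first exact: continuous_ln.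
by apply: cvgV => //; rewrite gt_eqF.
Qed.

(* The barrier is strictly superharmonic: its Laplacian is [- 4 / s ^+ 2]. *)
Lemma no_max_sub_barrier (R : realType) (u : R * R -> R) (a p : R * R) (eps d : R) :
  real_harmonic u -> 0 < eps -> 0 < sqdist a p -> 0 < d ->
  (forall (t : R) v, v = (1, 0) \/ v = (0, 1) -> `|t| < d ->
     u (p + t *: v) - eps * log_barrier (sqdist a (p + t *: v)) <=
     u p - eps * log_barrier (sqdist a p)) -> False.
Proof.
move=> [[uc du cdx cdy] lap] eps0 s0 d0 wmax.
have [_ ddx _ _] := cdx; have [_ ddy _ _] := cdy.
pose x := p.1 - a.1; pose y := p.2 - a.2.
have sE : sqdist a p = x ^+ 2 + y ^+ 2 by [].
(* For [|t| < d' z] one has [2 * |z| * |t| + |t| < sqdist a p], so the segment avoids [a]; the [+ 1]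
   keeps the denominator positive when [z = 0]. *)
pose d' (z : R) := Num.min d (sqdist a p / (2 * `|z| + 1)).
have d'0 z : 0 < d' z by rewrite lt_min d0 divr_gt0// ltr_wpDl// mulr_ge0.
have near_pos (z z' t : R) : sqdist a p = z ^+ 2 + z' ^+ 2 -> `|t| < d' z ->
    0 < (z + t) ^+ 2 + z' ^+ 2.
  move=> E; rewrite lt_min => /andP[_]; rewrite ltr_pdivlMr; last first.
    by rewrite ltr_wpDl// mulr_ge0.
  move=> ht.
  have : - (z * t) <= `|z| * `|t| by rewrite -normrM -normrN ler_norm.
  have := sqr_ge0 t; have := normr_ge0 t; nra.
(* Here [v] is a coordinate direction, [z] the coordinate of [p - a] along it and [z'] the other
   one; the bound is the second derivative test for [u - eps * log_barrier] on that line. *)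
have along v (z z' : R) (g2 : R) : v = (1, 0) \/ v = (0, 1) ->
    (forall q, derivable u q v) ->
    is_derive (0 : R) 1 (fun t : R => 'D_v u (p + t *: v)) g2 ->
    (forall t : R, sqdist a (p + t *: v) = (z + t) ^+ 2 + z' ^+ 2) ->
    g2 <= eps * (2 * ((z ^+ 2 + z' ^+ 2)^-1 + (z ^+ 2 + z' ^+ 2) ^- 2)
      - 4 * z ^+ 2 * ((z ^+ 2 + z' ^+ 2) ^- 2 + 2 * (z ^+ 2 + z' ^+ 2) ^- 3)).
  move=> vE dv d2 sv.
  have s0E : sqdist a p = z ^+ 2 + z' ^+ 2.
    by have := sv 0; rewrite scale0r !addr0.
  pose f t := u (p + t *: v) - eps * log_barrier ((z + t) ^+ 2 + z' ^+ 2).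
  pose f1 t := 'D_v u (p + t *: v) - eps *
    (2 * (z + t) * (((z + t) ^+ 2 + z' ^+ 2)^-1 + ((z + t) ^+ 2 + z' ^+ 2) ^- 2)).
  have df t : `|t| < d' z -> is_derive t (1 : R) f (f1 t).
    move=> td.
    have h1 := is_derive_along (dv (p + t *: v)).
    have h2 := derive_log_barrier (near_pos z z' t s0E td).
    exact: (is_deriveB h1 (is_deriveZ eps h2)).
  have h2 := @derive2_log_barrier _ z z'; rewrite -s0E in h2.
  have {}h2 := h2 s0; rewrite s0E in h2.
  have df1 := is_deriveB d2 (is_deriveZ eps h2).
  rewrite -subr_le0; apply: (second_derive_at_max (d'0 z) df df1).
  move=> t td; rewrite /f -!sv scale0r !addr0; apply: wmax => //.
  by move: td; rewrite lt_min => /andP[].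
have hx : dx (dx u) p <= eps * (2 * ((x ^+ 2 + y ^+ 2)^-1 + (x ^+ 2 + y ^+ 2) ^- 2)
      - 4 * x ^+ 2 * ((x ^+ 2 + y ^+ 2) ^- 2 + 2 * (x ^+ 2 + y ^+ 2) ^- 3)).
  apply: (along (1, 0)); [by left|exact: (fun q => (du q).1)| |].
  - have dp0 : derivable (dx u) (p + (0 : R) *: (1, 0)) (1, 0).
      by rewrite scale0r addr0; exact: (ddx p).1.
    by move: (is_derive_along dp0); rewrite scale0r addr0; exact.
  - by move=> t; rewrite /sqdist /= /x /y /GRing.scale /=; ring.
have hy : dy (dy u) p <= eps * (2 * ((y ^+ 2 + x ^+ 2)^-1 + (y ^+ 2 + x ^+ 2) ^- 2)
      - 4 * y ^+ 2 * ((y ^+ 2 + x ^+ 2) ^- 2 + 2 * (y ^+ 2 + x ^+ 2) ^- 3)).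
  apply: (along (0, 1)); [by right|exact: (fun q => (du q).2)| |].
  - have dp0 : derivable (dy u) (p + (0 : R) *: (0, 1)) (0, 1).
      by rewrite scale0r addr0; exact: (ddy p).2.
    by move: (is_derive_along dp0); rewrite scale0r addr0; exact.
  - by move=> t; rewrite /sqdist /= /x /y /GRing.scale /=; ring.
(* The two bounds add up to [- (4 * eps / s ^+ 2) < 0], whereas the second derivatives of [u] add up
   to 0. *)
have := lap p.
have : 0 < eps * (4 * (x ^+ 2 + y ^+ 2) ^- 2).
  by rewrite mulr_gt0// mulr_gt0// invr_gt0 exprn_gt0// -sE.
move: hx hy; rewrite [y ^+ 2 + x ^+ 2]addrC -sE; set s := sqdist a p.
have -> : y ^+ 2 = s - x ^+ 2 by rewrite /s sE; ring.
have E : (eps * (2 * (s^-1 + s ^- 2) - 4 * x ^+ 2 * (s ^- 2 + 2 * s ^- 3))) +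
  (eps * (2 * (s^-1 + s ^- 2) - 4 * (s - x ^+ 2) * (s ^- 2 + 2 * s ^- 3)))
  = - (eps * (4 * s ^- 2)) by field; rewrite gt_eqF.
by move: E; lra.
Qed.

Lemma bounded_harmonic_le (R : realType) (u : R * R -> R) (M : R) (a z : R * R) :
  real_harmonic u -> (forall q, u q <= M) -> u z <= u a.
Proof.
move=> hu uM.
have uc : continuous u by case: hu => -[].
have [->//|za] := eqVneq z a.
have sz0 : 0 < sqdist a z.
  rewrite lt_neqAle sqdist_ge0 andbT eq_sym; apply/eqP => s0; move: za.
  have /eqP := s0; rewrite paddr_eq0 ?sqr_ge0// !sqrf_eq0 !subr_eq0.
  by case: (z) (a) => [z1 z2] [a1 a2] /= /andP[/eqP-> /eqP->]; rewrite eqxx.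
apply/ler_addgt0Pr => e e0.
have : nbhs (u a) [set y : R | y < u a + e / 2].
  by apply: lt_nbhsl; rewrite ltrDl divr_gt0.
move=> /uc/nbhs_ballP[del /= del0 hdel].
(* The circle of radius [r] lies where [u < u a + e / 2]; since [r < 1], the bound [r < sqdist a z]
   gives [r ^+ 2 < sqdist a z], so [z] is outside it. *)
pose r := Num.min (del / 2) (Num.min 1 (Num.min (sqdist a z / 2) (1 / 2))).
have r0 : 0 < r by rewrite !lt_min; apply/and4P; split=> //; rewrite ?divr_gt0.
have [rdel rsz r1] : [/\ r < del, r < sqdist a z & r < 1].
  by split; rewrite !gt_min; apply/orP;
   [left|right; apply/orP; right; apply/orP; left|
    right; apply/orP; right; apply/orP; right]; lra.
have r2r : r ^+ 2 <= r by nra.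
have inner q : sqdist a q = r ^+ 2 -> u q < u a + e / 2.
  move=> qr; apply: hdel; split; rewrite /ball /= distrC;
    rewrite -(@ltr_pXn2r _ 2) ?nnegrE ?normr_ge0 ?ltW// real_normK ?num_real//;
    move: qr; rewrite /sqdist; have := sqr_ge0 (q.1 - a.1); have := sqr_ge0 (q.2 - a.2);
    have : r ^+ 2 < del ^+ 2 by rewrite ltr_pXn2r ?nnegrE ?ltW.
  - by lra.
  - by lra.
(* [D] is the gain of the barrier from the inner circle to [z]; [eps] limits its contribution to
   [e / 2], the other half of the tolerance. *)
pose D := log_barrier (sqdist a z) - log_barrier (r ^+ 2).
pose eps := e / (2 * (`|D| + 1)).
have D1 : 0 < 2 * (`|D| + 1) by rewrite mulr_gt0// ltr_wpDl.
have eps0 : 0 < eps by rewrite divr_gt0.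
have epsD : eps * D <= e / 2.
  have -> : e / 2 = eps * (`|D| + 1).
    by rewrite /eps; field; rewrite gt_eqF// ltr_wpDl.
  by apply: ler_wpM2l; [exact: ltW|have := ler_norm D; lra].
pose w q := u q - eps * log_barrier (sqdist a q).
pose A := (M - w z) / eps.
(* [rho] is a squared radius. The term [|A| + 2] gives [ln rho - rho^-1 >= |A| + 1 > A], hence
   [w < w z] on the outer circle; adding [sqdist a z] puts [z] inside it. *)
pose rho := expR (`|A| + 2) + sqdist a z.
have rho_ge : expR (`|A| + 2) <= rho by rewrite lerDl ltW.
have rho1 : 1 <= rho.
  by rewrite (le_trans _ rho_ge)// -[X in X <= _]expR0 ler_expR addr_ge0.
have rho0 : 0 < rho by lra.
have Grho : A < log_barrier rho.
  have h1 : `|A| + 2 <= ln rho by rewrite -[X in X <= _]expRK ler_ln ?posrE ?expR_gt0.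
  have h2 : rho^-1 <= 1 by rewrite invf_le1.
  have := ler_norm A; rewrite /log_barrier; lra.
have outer q : sqdist a q = rho -> w q < w z.
  move=> qrho; rewrite /w qrho; move: Grho; rewrite /A ltr_pdivrMr//.
  have := uM q; rewrite /w; lra.
pose Ann := [set q | r ^+ 2 <= sqdist a q <= rho].
have zAnn : Ann z.
  rewrite /Ann /=; apply/andP; split; first by lra.
  by rewrite lerDr expR_ge0.
have cAnn : compact Ann.
  apply: (@subclosed_compact _ _
    (`[a.1 - rho, a.1 + rho]%classic `*` `[a.2 - rho, a.2 + rho]%classic)).
  - have -> : Ann = sqdist a @^-1` `[r ^+ 2, rho]%classic.
      by apply/seteqP; split => q /=; rewrite in_itv.
    apply: preimage_closed; last exact: itv_closed.
    by move=> x _; exact: continuous_sqdist.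
  - by apply: compact_setX; exact: segment_compact.
  - move=> q /andP[_]; rewrite /sqdist => qrho.
    have h1 := sqr_ge0 (q.1 - a.1); have h2 := sqr_ge0 (q.2 - a.2).
    by split => /=; rewrite in_itv /=; apply/andP; split; nra.
have AnnP q : Ann q -> 0 < sqdist a q.
  by move=> /andP[+ _]; apply: lt_le_trans; rewrite exprn_gt0.
have wc q : 0 < sqdist a q -> {for q, continuous w}.
  move=> q0; apply: cvgB; first exact: uc.
  apply: cvgMr.
  apply: (@continuous_comp _ _ _ (sqdist a) (@log_barrier R)).
    exact: continuous_sqdist.
  exact: continuous_log_barrier.
have [|p pA pmax] := @compact_EVT_max _ _ w Ann (ex_intro _ z zAnn) cAnn.
  by apply: continuous_in_subspaceT => q /set_mem /AnnP; exact: wc.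
move: pA => /set_mem pA.
have zp : w z <= w p by apply: pmax; exact/mem_set.
(* A maximum on the inner circle yields the claim; one on the outer circle contradicts [outer], and
   one in the open annulus contradicts the strict superharmonicity of the barrier. *)
have [pr|pr] := eqVneq (sqdist a p) (r ^+ 2).
  have := inner p pr; move: zp epsD; rewrite /w pr /D; lra.
have [prho|prho] := eqVneq (sqdist a p) rho.
  by have := outer p prho; rewrite ltNge zp.
have : nbhs (sqdist a p) `](r ^+ 2), rho[%classic.
  apply: near_in_itvoo; rewrite in_itv /= !lt_neqAle prho eq_sym pr /=.
  by move: pA; rewrite /Ann.
move=> /(@continuous_sqdist _ a p)/nbhs_ballP[d /= d0 hd].
exfalso; apply: (@no_max_sub_barrier _ u a p eps d) => //; first exact: AnnP.
move=> t v vE td; apply: pmax; apply/mem_set.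
suff : `](r ^+ 2), rho[%classic (sqdist a (p + t *: v)).
  by rewrite /Ann /= in_itv /= => /andP[/ltW -> /ltW ->].
apply: hd.
have td' : `|- t| < d by rewrite normrN.
by case: vE => ->; split; rewrite /ball /= /GRing.scale /= ?mulr1 ?mulr0 ?addr0
  ?subrr ?normr0// opprD addrA subrr sub0r.
Qed.

Lemma bounded_harmonic_constant (R : realType) (u : R * R -> R) (M : R) :
  real_harmonic u -> (forall q, `|u q| <= M) -> forall p q, u p = u q.
Proof.
move=> hu uM p q.
have le_uM x : u x <= M by rewrite (le_trans (ler_norm _)).
by apply/eqP; rewrite eq_le !(bounded_harmonic_le _ _ hu le_uM).
Qed.

(** * Gaussian moments *)

(** This is the normal density of variance [1 / (2 * a)]; the Gaussian weight of the plane is the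
    product of two such factors. *)
Definition gauss1 (R : realType) (a x : R) : R :=
  Num.sqrt (a / pi) * expR (- a * x ^+ 2).

Lemma gauss1_ge0 (R : realType) (a x : R) : 0 <= gauss1 a x.
Proof. by rewrite mulr_ge0 ?sqrtr_ge0 ?expR_ge0. Qed.

Lemma gauss1_normal_pdf (R : realType) (a : R) : 0 < a ->
  gauss1 a = normal_pdf 0 (Num.sqrt (a * 2))^-1.
Proof.
move=> a0.
have a20 : 0 < a * 2 by rewrite mulr_gt0.
have s0 : (Num.sqrt (a * 2))^-1 != 0 by rewrite invr_neq0// gt_eqF// sqrtr_gt0.
rewrite normal_pdfE//; apply/funext => x; rewrite /gauss1 /normal_peak /normal_fun.
rewrite exprVn sqr_sqrtr ?ltW// subr0.
have pi0 : 0 < (pi : R) := pi_gt0 R.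
have E : ((a * 2)^-1 * pi *+ 2)^-1 = a / pi.
  move: (pi : R) pi0 => p p0.
  by rewrite -(mulr_natr (_ * p)); field; rewrite !gt_eqF.
congr (_ * expR _).
  by rewrite -E sqrtrV// mulrn_wge0// mulr_ge0 ?invr_ge0 ?ltW.
by rewrite -(mulr_natr (_^-1)); field; rewrite gt_eqF.
Qed.

(** Raise [1 + s <= expR s] at [s = t / k] to the power [k]. *)
Lemma expn_le_expR (R : realType) (k : nat) (t : R) :
  0 <= t -> t ^+ k <= k%:R ^+ k * expR t.
Proof.
move=> t0; case: k => [|k].
  by rewrite !expr0 mul1r -[X in X <= _]expR0 ler_expR.
have -> : expR t = expR (t / k.+1%:R) ^+ k.+1.
  by rewrite -expRM_natl; congr expR; field.
rewrite -exprMn lerXn2r ?nnegrE// ?mulr_ge0 ?expR_ge0//.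
have h1 := expR_ge1Dx (t / k.+1%:R).
by rewrite -ler_pdivrMl ?ltr0n// mulrC (le_trans _ h1)// lerDr.
Qed.

Lemma norm_expn_gauss_bounded (R : realType) (k : nat) (b : R) : 0 < b ->
  exists2 C, 0 <= C & forall x : R, `|x| ^+ k * expR (- b * x ^+ 2) <= C.
Proof.
move=> b0; exists (1 + k%:R ^+ k / b ^+ k).
  by rewrite addr_ge0// divr_ge0// exprn_ge0// ltW.
move=> x.
have e1 : expR (- b * x ^+ 2) <= 1.
  by rewrite -[leRHS]expR0 ler_expR mulNr oppr_le0 mulr_ge0 ?sqr_ge0// ltW.
(* This follows from [(|x| ^+ k - 1) ^+ 2 >= 0], and leaves only powers of [x ^+ 2], to which
   [expn_le_expR] applies with [t = b * x ^+ 2]. *)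
have xk : `|x| ^+ k <= 1 + x ^+ 2 ^+ k.
  have -> : x ^+ 2 = `|x| ^+ 2 by rewrite real_normK ?num_real.
  rewrite -exprM mulnC exprM; have := sqr_ge0 (`|x| ^+ k - 1); nra.
have e2 : x ^+ 2 ^+ k * expR (- b * x ^+ 2) <= k%:R ^+ k / b ^+ k.
  rewrite ler_pdivlMr ?exprn_gt0// mulrAC -exprMn mulNr expRN.
  rewrite ler_pdivrMr ?expR_gt0// [x ^+ 2 * b]mulrC.
  by apply: expn_le_expR; rewrite mulr_ge0 ?sqr_ge0// ltW.
have := expR_ge0 (- b * x ^+ 2).
set E := expR _ in e1 e2 *; move=> E0.
have := ler_wpM2r E0 xk; rewrite mulrDl mul1r; lra.
Qed.

Section gaussian_moments.
Context {R : realType}.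
Local Notation mu := (@lebesgue_measure R).
Variable a : R.
Hypothesis a0 : 0 < a.

Lemma integrable_gauss1 (b : R) : 0 < b -> mu.-integrable setT (EFin \o gauss1 b).
Proof. by move=> b0; rewrite gauss1_normal_pdf//; exact: integrable_normal_pdf. Qed.

Lemma Rintegral_gauss1 : \int[mu]_x gauss1 a x = 1.
Proof. by rewrite /Rintegral gauss1_normal_pdf// integral_normal_pdf. Qed.

Lemma continuous_gauss1 : continuous (gauss1 a).
Proof.
have s0 : (Num.sqrt (a * 2))^-1 != 0.
  by rewrite invr_neq0// gt_eqF// sqrtr_gt0 mulr_gt0.
by rewrite gauss1_normal_pdf//; exact: continuous_normal_pdf.
Qed.

Lemma continuous_expn_gauss1 (k : nat) : continuous (fun x : R => x ^+ k * gauss1 a x).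
Proof.
by move=> x; apply: cvgM; [exact: exprn_continuous|exact: continuous_gauss1].
Qed.

(** Half of the exponent absorbs the power of [x]; the other half is a Gaussian of parameter
    [a / 2], and [D] adjusts the normalising constants. *)
Lemma integrable_expn_gauss1 (k : nat) :
  mu.-integrable setT (EFin \o (fun x : R => x ^+ k * gauss1 a x)).
Proof.
have a20 : 0 < a / 2 by rewrite divr_gt0.
have [C C0 HC] := norm_expn_gauss_bounded k a20.
pose D := C * (Num.sqrt (a / pi) / Num.sqrt (a / 2 / pi)).
apply: (@le_integrable _ _ _ mu setT measurableT _ (fun x => (D%:E * (gauss1 (a / 2) x)%:E)%E)).
- apply/measurable_EFinP; apply: continuous_measurable_fun.
  exact: continuous_expn_gauss1.
- move=> x _ /=; rewrite lee_fin normrM (ger0_norm (gauss1_ge0 _ _)) normrX.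
  rewrite [leRHS]ger0_norm; last first.
    by rewrite mulr_ge0 ?gauss1_ge0// mulr_ge0// divr_ge0 ?sqrtr_ge0.
  rewrite /gauss1 /D.
  have s0 : 0 < Num.sqrt (a / 2 / pi) by rewrite sqrtr_gt0 divr_gt0 ?pi_gt0.
  have E : expR (- a * x ^+ 2) = expR (- (a / 2) * x ^+ 2) * expR (- (a / 2) * x ^+ 2).
    by rewrite -expRD; congr expR; field.
  have -> : C * (Num.sqrt (a / pi) / Num.sqrt (a / 2 / pi)) *
    (Num.sqrt (a / 2 / pi) * expR (- (a / 2) * x ^+ 2)) =
    C * (Num.sqrt (a / pi) * expR (- (a / 2) * x ^+ 2)) by field; rewrite gt_eqF.
  rewrite E; set e := expR _.
  rewrite (_ : _ * _ = (`|x| ^+ k * e) * (Num.sqrt (a / pi) * e)); last by ring.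
  by apply: ler_wpM2r => //; rewrite mulr_ge0 ?sqrtr_ge0 ?expR_ge0.
- by apply: integrableZl => //; exact: integrable_gauss1.
Qed.

Definition gauss_moment (k : nat) : R := \int[mu]_x (x ^+ k * gauss1 a x).

Lemma gauss_moment0 : gauss_moment 0 = 1.
Proof. by rewrite -Rintegral_gauss1; apply: eq_Rintegral => x _; rewrite expr0 mul1r. Qed.

(** The integral of this derivative over the line vanishes, which is the recursion for the moments.
    For [k = 0] the exponent [k.-1] is harmless, as its coefficient is 0. *)
Lemma is_derive_expn_gauss1 (k : nat) (x : R) :
  is_derive x (1 : R) (fun x : R => x ^+ k * gauss1 a x)
    (k%:R * x ^+ k.-1 * gauss1 a x - 2 * a * (x ^+ k.+1 * gauss1 a x)).
Proof.
have dg : is_derive x (1 : R) (gauss1 a) (- (2 * a * x) * gauss1 a x).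
  have h1 : is_derive x (1 : R) (fun x => - a * x ^+ 2) (- (2 * a * x)).
    by apply: is_derive_eq; rewrite /GRing.scale /=; ring.
  have h2 := is_derive_expR (- a * x ^+ 2).
  have h3 : is_derive x (1 : R) (fun x => expR (- a * x ^+ 2))
      (expR (- a * x ^+ 2) * - (2 * a * x)).
    exact: (@is_derive1_comp _ expR (fun x => - a * x ^+ 2) x _ _ h2 h1).
  have h4 := is_deriveZ (Num.sqrt (a / pi)) h3.
  rewrite (_ : - (2 * a * x) * gauss1 a x = Num.sqrt (a / pi) *: (expR (- a * x ^+ 2) * - (2 * a * x))).
    exact: h4.
  by rewrite /gauss1 /GRing.scale /=; ring.
have dX : is_derive x (1 : R) (fun x : R => x ^+ k) (k%:R * x ^+ k.-1).
  by split; [exact: exprn_derivable|rewrite exp_derive /GRing.scale /= mulr1].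
have h5 := is_deriveM dX dg.
rewrite (_ : _ - _ = x ^+ k *: (- (2 * a * x) * gauss1 a x) + gauss1 a x *: (k%:R * x ^+ k.-1)).
  exact: h5.
rewrite /GRing.scale /= exprS; ring.
Qed.

(** One more power of [|x|] is still bounded, which leaves a factor [1 / (n + 1)]. The sign [s]
    covers both ends of the line. *)
Lemma expn_gauss1_vanishes (k : nat) (s : R) : `|s| = 1 ->
  (fun n : nat => (s * n.+1%:R) ^+ k * gauss1 a (s * n.+1%:R)) @ \oo --> (0 : R).
Proof.
move=> s1; have [C C0 HC] := norm_expn_gauss_bounded k.+1 a0.
have gn : (fun n : nat => (C * Num.sqrt (a / pi)) * n.+1%:R^-1) @ \oo --> (0 : R).
  by rewrite -(mulr0 (C * Num.sqrt (a / pi))); apply: cvgMr; exact: cvg_harmonic.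
apply/norm_cvg0P; apply: squeeze_cvgr gn; last exact: cvg_cst.
apply: nearW => n; rewrite normr_ge0 /=.
rewrite normrM (ger0_norm (gauss1_ge0 _ _)) normrX normrM s1 mul1r normr_nat.
have := HC (s * n.+1%:R); rewrite normrM s1 mul1r normr_nat exprSr /gauss1.
rewrite ler_pdivlMr ?ltr0n//; have := sqrtr_ge0 (a / pi).
set e := expR _; set q := Num.sqrt _ => q0 h.
have := ler_wpM2r q0 h; apply: le_trans.
by rewrite le_eqVlt; apply/orP; left; apply/eqP; ring.
Qed.

Lemma gauss_moment_derive (k : nat) :
  \int[mu]_x (k%:R * x ^+ k.-1 * gauss1 a x - 2 * a * (x ^+ k.+1 * gauss1 a x)) = 0.
Proof.
pose f (x : R) := k%:R * x ^+ k.-1 * gauss1 a x - 2 * a * (x ^+ k.+1 * gauss1 a x).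
rewrite -/(Rintegral mu setT f).
pose F (x : R) := x ^+ k * gauss1 a x.
have intf : mu.-integrable setT (EFin \o f).
  have -> : EFin \o f = (fun x => (k%:R%:E * (x ^+ k.-1 * gauss1 a x)%:E)
      - ((2 * a)%:E * (x ^+ k.+1 * gauss1 a x)%:E))%E.
    by apply/funext => x; rewrite /f /= -!EFinM -EFinB [in RHS]mulrA.
  by apply: (integrableB measurableT); apply: (integrableZl measurableT);
     exact: integrable_expn_gauss1.
have cf : continuous f.
  have -> : f = (fun x : R => k%:R * (x ^+ k.-1 * gauss1 a x)) \-
      (fun x => 2 * a * (x ^+ k.+1 * gauss1 a x)).
    by apply/funext => x /=; rewrite /f [in RHS]mulrA.
  by move=> x; apply: cvgB; apply: cvgMr; exact: continuous_expn_gauss1.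
have mf : measurable_fun setT f by exact: continuous_measurable_fun.
(* The fundamental theorem of calculus evaluates the integral on each of these intervals, and
   dominated convergence passes to the whole line. *)
pose I (n : nat) := `[(- n.+1%:R : R), n.+1%:R]%classic.
have FTC n : (\int[mu]_(x in I n) (f x)%:E = (F n.+1%:R)%:E - (F (- n.+1%:R))%:E)%E.
  have dF x : is_derive x (1 : R) F (f x) by exact: is_derive_expn_gauss1.
  have cF : continuous F by exact: continuous_expn_gauss1.
  apply: continuous_FTC2.
  - by rewrite (@lt_trans _ _ 0)// oppr_lt0.
  - exact: continuous_subspaceT.
  - split.
    + by move=> x _; case: (dF x).
    + exact/cvg_at_right_filter/cF.
    + exact/cvg_at_left_filter/cF.
  - by move=> x _; rewrite derive1E; case: (dF x).
have mI n : measurable (I n) by exact: measurable_itv.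
have [|||||_ _] := @dominated_convergence _ _ _ mu setT measurableT
  (fun n => (EFin \o f) \_ (I n)) (EFin \o f) (EFin \o (Num.norm \o f)).
- move=> n; apply/(measurable_restrictT _ (mI n)).
  by apply: measurable_funTS; exact/measurable_EFinP.
- exact/measurable_EFinP.
- apply: aeW => x _; apply: cvg_near_cst.
  near=> n; rewrite patchE mem_set// /I /= in_itv /= -ler_norml.
  apply: (@le_trans _ _ n%:R); last by rewrite ler_nat.
  near: n; exact: nbhs_infty_ger.
- exact: integrable_norm.
- apply: aeW => x n _; rewrite patchE; case: ifPn => _ //=.
  by rewrite normr0 lee_fin.
under eq_fun do rewrite -integral_mkcond FTC -EFinB.
move=> dom; rewrite /Rintegral.
have lim0 : (fun n : nat => (F n.+1%:R - F (- n.+1%:R))%:E) @ \oo --> (0%:E : \bar R).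
  apply: cvg_EFin; first exact: nearW.
  rewrite -[X in _ --> X](subr0 (0 : R)) /=; apply: cvgB.
  - have := @expn_gauss1_vanishes k 1 (normr1 _).
    by under eq_fun do rewrite mul1r.
  - have := @expn_gauss1_vanishes k (- 1) (normrN1 _).
    by under eq_fun do rewrite mulN1r.
by rewrite (cvg_unique _ dom lim0).
Unshelve. all: by end_near. Qed.

(* Valid for all [k]: for [k = 0] it says that the first moment vanishes. *)
Lemma gauss_momentS (k : nat) :
  2 * a * gauss_moment k.+1 = k%:R * gauss_moment k.-1.
Proof.
apply/esym/eqP; rewrite -subr_eq0; apply/eqP.
rewrite -[RHS](gauss_moment_derive k) /gauss_moment -!RintegralZl//.
- rewrite -RintegralB//.
  + by apply: eq_Rintegral => x _; rewrite mulrA.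
  + exact: (integrableZl measurableT k%:R (integrable_expn_gauss1 _)).
  + exact: (integrableZl measurableT (2 * a) (integrable_expn_gauss1 _)).
- exact: integrable_expn_gauss1.
- exact: integrable_expn_gauss1.
Qed.
End gaussian_moments.

(** * Orthonormality of the monomials *)

Section complex_integral.
Context {R : realType}.
Implicit Types (f g h : R[i] -> R[i]) (c : R[i]).
Local Notation area := (@lebesgue_measure R \x @lebesgue_measure R)%E.
Local Notation normc := ComplexField.Normc.normc.
Local Notation Re := complex.Re.
Local Notation Im := complex.Im.

Lemma complex_eq c d : Re c = Re d -> Im c = Im d -> c = d.
Proof. by case: c d => [a b] [x y] /= -> ->. Qed.

Lemma ReD c d : Re (c + d) = Re c + Re d. Proof. by case: c d => ? ? []. Qed.
Lemma ImD c d : Im (c + d) = Im c + Im d. Proof. by case: c d => ? ? []. Qed.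
Lemma ReN c : Re (- c) = - Re c. Proof. by case: c. Qed.
Lemma ImN c : Im (- c) = - Im c. Proof. by case: c. Qed.
Lemma ReM c d : Re (c * d) = Re c * Re d - Im c * Im d.
Proof. by case: c d => ? ? []. Qed.
Lemma ImM c d : Im (c * d) = Re c * Im d + Im c * Re d.
Proof. by case: c d => ? ? []. Qed.
Lemma Re_conj c : Re c^*%C = Re c. Proof. by case: c. Qed.
Lemma Im_conj c : Im c^*%C = - Im c. Proof. by case: c. Qed.

Lemma sqr_normc c : normc c ^+ 2 = Re c ^+ 2 + Im c ^+ 2.
Proof. by case: c => a b /=; rewrite sqr_sqrtr// addr_ge0 ?sqr_ge0. Qed.

Lemma normc_ge0 c : 0 <= normc c.
Proof. by case: c => a b; exact: sqrtr_ge0. Qed.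

Lemma sqr_normcM c d : normc (c * d) ^+ 2 = normc c ^+ 2 * normc d ^+ 2.
Proof. by rewrite !sqr_normc ReM ImM; ring. Qed.

Lemma mulc_conj c : c * c^*%C = (normc c ^+ 2)%:C%C.
Proof.
by apply: complex_eq; rewrite sqr_normc ?ReM ?ImM Re_conj Im_conj /=; ring.
Qed.

Lemma conjcM c d : (c * d)^*%C = c^*%C * d^*%C.
Proof. by apply: complex_eq; rewrite !(ReM, ImM, Re_conj, Im_conj) /=; ring. Qed.

Variable alpha : R.
Hypothesis alpha0 : 0 < alpha.
Local Notation wt p := (gauss_weight alpha (cxy p)).

Lemma gauss_weight_gt0 (z : R[i]) : 0 < gauss_weight alpha z.
Proof. by rewrite /gauss_weight mulr_gt0 ?expR_gt0// divr_gt0// pi_gt0. Qed.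

Lemma gauss_weightE (p : R * R) : wt p = gauss1 alpha p.1 * gauss1 alpha p.2.
Proof.
rewrite /gauss_weight /gauss1 sqr_normc /= mulrDr expRD.
have h : alpha / pi = Num.sqrt (alpha / pi) * Num.sqrt (alpha / pi).
  by rewrite -expr2 sqr_sqrtr// ltW// divr_gt0// pi_gt0.
by rewrite {1}h; ring.
Qed.

Lemma measurable_gauss_weight :
  measurable_fun [set: measurableTypeR R * measurableTypeR R]
    (fun p => wt p : measurableTypeR R).
Proof.
rewrite (_ : (fun p => wt p) = (fun p => gauss1 alpha p.1 * gauss1 alpha p.2)).
  have mg : measurable_fun [set: measurableTypeR R] (gauss1 alpha).
    by apply: continuous_measurable_fun; exact: continuous_gauss1.
  by apply: measurable_funM; apply: measurableT_comp.
by apply/funext => p; exact: gauss_weightE.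
Qed.

Definition cintegrable h :=
  area.-integrable setT (fun p => (Re (h (cxy p)) * wt p)%:E) /\
  area.-integrable setT (fun p => (Im (h (cxy p)) * wt p)%:E).

Definition cint h : R[i] :=
  ((\int[area]_p (Re (h (cxy p)) * wt p))%R +i*
   (\int[area]_p (Im (h (cxy p)) * wt p))%R)%C.

Lemma innerE f g : inner alpha f g = cint (fun z => f z * (g z)^*%C).
Proof. by []. Qed.

Lemma cintegrable_lin c f g : cintegrable f -> cintegrable g ->
  cintegrable (fun z => c * f z + g z).
Proof.
move=> [rf jf] [rg jg]; split.
- rewrite (_ : (fun p => _) = (fun p =>
    (((Re c)%:E * (Re (f (cxy p)) * wt p)%:E + (- Im c)%:E * (Im (f (cxy p)) * wt p)%:E)
     + (Re (g (cxy p)) * wt p)%:E)%E)); last first.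
    by apply/funext => p; rewrite -!EFinM -!EFinD ReD ReM; congr EFin; ring.
  by do !apply: (integrableD measurableT) => //; exact: (integrableZl measurableT).
- rewrite (_ : (fun p => _) = (fun p =>
    (((Re c)%:E * (Im (f (cxy p)) * wt p)%:E + (Im c)%:E * (Re (f (cxy p)) * wt p)%:E)
     + (Im (g (cxy p)) * wt p)%:E)%E)); last first.
    by apply/funext => p; rewrite -!EFinM -!EFinD ImD ImM; congr EFin; ring.
  by do !apply: (integrableD measurableT) => //; exact: (integrableZl measurableT).
Qed.

Lemma cint_lin c f g : cintegrable f -> cintegrable g ->
  cint (fun z => c * f z + g z) = c * cint f + cint g.
Proof.
move=> [rf jf] [rg jg].
have Zl k u : area.-integrable setT (fun p => (u p * wt p)%:E) ->
    area.-integrable setT (fun p => (k * (u p * wt p))%:E).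
  exact: (integrableZl measurableT).
apply: complex_eq; rewrite ?(ReD, ReM, ImD, ImM) /=.
- under eq_Rintegral => p _ do rewrite ReD ReM mulrDl mulrBl -!mulrA.
  rewrite RintegralD// ?RintegralB// ?RintegralZl//; try exact: Zl.
  exact: (integrableB measurableT (Zl _ _ rf) (Zl _ _ jf)).
- under eq_Rintegral => p _ do rewrite ImD ImM !mulrDl -!mulrA.
  rewrite RintegralD// ?RintegralD// ?RintegralZl//; try exact: Zl.
  exact: (integrableD measurableT (Zl _ _ jf) (Zl _ _ rf)).
Qed.

Lemma cint0 : cint (fun=> 0) = 0.
Proof.
by apply: complex_eq => /=; rewrite /Rintegral; under eq_integral do rewrite mul0r;
  rewrite integral0.
Qed.

Lemma cintegrable0 : cintegrable (fun=> 0).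
Proof.
split; rewrite (_ : (fun p => _) = cst 0%E); try exact: integrable0;
by apply/funext => p /=; rewrite mul0r.
Qed.

Lemma cint_conj h : cintegrable h -> cint (fun z => (h z)^*%C) = (cint h)^*%C.
Proof.
move=> [rh jh]; apply: complex_eq; rewrite ?(Re_conj, Im_conj) /=.
- by under eq_Rintegral do rewrite Re_conj.
- under eq_Rintegral do rewrite Im_conj mulNr -mulN1r.
  by rewrite RintegralZl// mulN1r.
Qed.

Lemma cint_ae f g : cmeasurable f -> cmeasurable g -> ae_equal f g ->
  cint f = cint g.
Proof.
move=> [rf jf] [rg jg] fg; apply: complex_eq => /=; rewrite /Rintegral;
 congr fine; apply: ae_eq_integral => //.
- by apply/measurable_EFinP/measurable_funM => //; exact: measurable_gauss_weight.
- by apply/measurable_EFinP/measurable_funM => //; exact: measurable_gauss_weight.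
- case: fg => N [mN N0 sub]; exists N; split => // p np; apply: sub => /= E.
  by apply: np => _; rewrite E.
- by apply/measurable_EFinP/measurable_funM => //; exact: measurable_gauss_weight.
- by apply/measurable_EFinP/measurable_funM => //; exact: measurable_gauss_weight.
- case: fg => N [mN N0 sub]; exists N; split => // p np; apply: sub => /= E.
  by apply: np => _; rewrite E.
Qed.
End complex_integral.

Section product_integral.
Context d1 d2 (T1 : measurableType d1) (T2 : measurableType d2) {R : realType}.
Variables (m1 : {sigma_finite_measure set T1 -> \bar R})
          (m2 : {sigma_finite_measure set T2 -> \bar R}).
Variables (u : T1 -> R) (v : T2 -> R).
Hypotheses (iu : m1.-integrable setT (EFin \o u))
           (iv : m2.-integrable setT (EFin \o v)).

(** By Tonelli, the iterated integral of [|u x| * |v y|] is a product of two finite numbers. *)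
Lemma integrable_prodM :
  (m1 \x m2)%E.-integrable setT (EFin \o (fun p => u p.1 * v p.2)).
Proof.
have mu := measurable_int _ iu; have mv := measurable_int _ iv.
move/measurable_EFinP in mu; move/measurable_EFinP in mv.
apply/integrable12ltyP.
  apply/measurable_EFinP; apply: measurable_funM; exact: measurableT_comp.
rewrite (_ : (\int[m1]_x _)%E =
  (\int[m1]_x (`|u x|%:E * (\int[m2]_y `|v y|%:E)))%E); last first.
  apply: eq_integral => x _; rewrite -ge0_integralZl//.
  - by apply: eq_integral => y _ /=; rewrite -EFinM normrM.
  - by apply/measurable_EFinP; exact: measurableT_comp.
have /integrableP[_ uoo] := iu; have /integrableP[_ voo] := iv.
have ufin : (\int[m1]_x `|u x|%:E)%E \is a fin_num.
  by rewrite ge0_fin_numE// integral_ge0.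
have vfin : (\int[m2]_y `|v y|%:E)%E \is a fin_num.
  by rewrite ge0_fin_numE// integral_ge0.
rewrite -(fineK vfin) ge0_integralZr//.
- by rewrite -(fineK ufin) -EFinM ltry.
- by apply/measurable_EFinP; exact: measurableT_comp.
- by rewrite lee_fin fine_ge0// integral_ge0.
Qed.

Lemma Rintegral_prodM : \int[(m1 \x m2)%E]_p (u p.1 * v p.2) =
  (\int[m1]_x u x) * (\int[m2]_y v y).
Proof.
rewrite /Rintegral -(integral12_prod_meas1 integrable_prodM) /fubini_F /=.
have ufin : (\int[m1]_x (u x)%:E)%E \is a fin_num by exact: integrable_fin_num.
have vfin : (\int[m2]_y (v y)%:E)%E \is a fin_num by exact: integrable_fin_num.
rewrite -fineM//; congr fine.
rewrite -[in RHS](fineK vfin) -integralZr//; apply: eq_integral => x _.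
by rewrite fineK// -integralZl.
Qed.
End product_integral.

Section monomial_integrals.
Context {R : realType}.
Variable alpha : R.
Hypothesis alpha0 : 0 < alpha.
Local Notation area := (@lebesgue_measure R \x @lebesgue_measure R)%E.
Local Notation Re := complex.Re.
Local Notation Im := complex.Im.
Local Notation wt p := (gauss_weight alpha (cxy p)).

(** The real factors [x ^+ j * y ^+ k] make the family closed under expanding a factor [z] as
    [x + i y] or its conjugate as [x - i y], so that every integral reduces to products of
    one-dimensional moments. *)
Definition mixed_monomial (j k n m : nat) (z : R[i]) : R[i] :=
  (Re z ^+ j * Im z ^+ k)%:C%C * (z ^+ n * (z^*)%C ^+ m).

Local Notation I := (@cint R alpha).
Let J j k n m := I (mixed_monomial j k n m).

Lemma integrable_real_monomial j k :
  area.-integrable setT (EFin \o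
    (fun p => (p.1 ^+ j * gauss1 alpha p.1) * (p.2 ^+ k * gauss1 alpha p.2))).
Proof.
exact: (@integrable_prodM _ _ _ _ _ (@lebesgue_measure R) (@lebesgue_measure R)
  (fun x => x ^+ j * gauss1 alpha x) (fun x => x ^+ k * gauss1 alpha x)
  (integrable_expn_gauss1 alpha0 j) (integrable_expn_gauss1 alpha0 k)).
Qed.

Lemma mixed_monomialS j k n m : mixed_monomial j k n.+1 m =
  (fun z => 'i%C * mixed_monomial j k.+1 n m z + mixed_monomial j.+1 k n m z).
Proof.
apply/funext => z; rewrite /mixed_monomial exprS.
rewrite [X in X * z ^+ n](_ : z = (Re z)%:C%C + 'i%C * (Im z)%:C%C).
  by rewrite !rmorphM /= !rmorphXn /= !exprS; ring.
by case: z => x y; apply: complex_eq; rewrite ?(ReD, ReM, ImD, ImM) /=; ring.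
Qed.

Lemma mixed_monomial_conjS j k n m : mixed_monomial j k n m.+1 =
  (fun z => (- 'i%C) * mixed_monomial j k.+1 n m z + mixed_monomial j.+1 k n m z).
Proof.
apply/funext => z; rewrite /mixed_monomial [in LHS](exprS z^*%C).
rewrite [X in X * z^*%C ^+ m](_ : z^*%C = (Re z)%:C%C - 'i%C * (Im z)%:C%C).
  by rewrite !rmorphM /= !rmorphXn /= !exprS; ring.
by case: z => x y; apply: complex_eq; rewrite ?(ReD, ReM, ImD, ImM, ReN, ImN) /=; ring.
Qed.

Lemma cintegrable_mixed j k n m : cintegrable alpha (mixed_monomial j k n m).
Proof.
elim: n j k m => [|n IHn] j k m; last first.
  by rewrite mixed_monomialS; apply: cintegrable_lin; exact: IHn.
elim: m j k => [|m IHm] j k; last first.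
  by rewrite mixed_monomial_conjS; apply: cintegrable_lin; exact: IHm.
have E p : mixed_monomial j k 0 0 (cxy p) = (p.1 ^+ j * p.2 ^+ k)%:C%C.
  by rewrite /mixed_monomial !expr0 !mulr1.
split.
- under eq_fun do rewrite E.
  have := integrable_real_monomial j k; congr (_.-integrable _ _).
  by apply/funext => p; rewrite gauss_weightE//=; congr EFin; ring.
- under eq_fun do rewrite E /= mul0r.
  exact: integrable0.
Qed.

Lemma mixed0 j k : J j k 0 0 = (gauss_moment alpha j * gauss_moment alpha k)%:C%C.
Proof.
have E p : mixed_monomial j k 0 0 (cxy p) = (p.1 ^+ j * p.2 ^+ k)%:C%C.
  by rewrite /mixed_monomial !expr0 !mulr1.
rewrite /J /cint; congr (_ +i* _)%C.
- rewrite /gauss_moment -Rintegral_prodM; try exact: integrable_expn_gauss1.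
  by apply: eq_Rintegral => p _; rewrite E gauss_weightE//=; ring.
- rewrite /Rintegral (_ : (\int[_]_p _)%E = 0%E)//.
  rewrite -[RHS](integral0 area setT); apply: eq_integral => p _.
  by rewrite E /= mul0r.
Qed.

Lemma mixedS j k n m : J j k n.+1 m = 'i%C * J j k.+1 n m + J j.+1 k n m.
Proof. by rewrite /J mixed_monomialS cint_lin//; exact: cintegrable_mixed. Qed.

Lemma mixed_conjS j k n m : J j k n m.+1 = - 'i%C * J j k.+1 n m + J j.+1 k n m.
Proof. by rewrite /J mixed_monomial_conjS cint_lin//; exact: cintegrable_mixed. Qed.

(* Integration by parts in [x] and in [y]; terms with index [0.-1] have
   coefficient [0]. *)
Lemma mixed_parts_re j k n m :
  j%:R * J j.-1 k n m + n%:R * J j k n.-1 m + m%:R * J j k n m.-1 =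
  2 * alpha%:C%C * J j.+1 k n m.
Proof.
have base j' k' : j'%:R * J j'.-1 k' 0 0 = 2 * alpha%:C%C * J j'.+1 k' 0 0.
  rewrite !mixed0.
  have : (2 * alpha * gauss_moment alpha j'.+1 * gauss_moment alpha k')%:C%C =
    (j'%:R * gauss_moment alpha j'.-1 * gauss_moment alpha k')%:C%C.
    by rewrite gauss_momentS.
  rewrite !rmorphM /= !rmorph_nat => h.
  apply: (eq_trans _ (eq_trans (esym h) _)); ring.
(* What remains uses only the two expansion rules and the base case; with the integral, [i] and
   [alpha] abstracted it is a formal identity for [ring]. *)
move: mixedS mixed_conjS base; move: (J) ('i%C) (alpha%:C%C) => u I a uS u_conjS base.
elim: n j k m => [|n IHn] j k m.
  elim: m j k => [|m IHm] j k; first by rewrite !mul0r !addr0 base.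
  have h1 := IHm j.+1 k; have h2 := IHm j k.+1.
  (* Expanding one conjugate factor as [x - i y] combines the hypotheses at [j.+1] and at [k.+1];
     the case splits resolve the predecessors. *)
  have h := congr2 (fun x y => - I * y + x) h1 h2.
  case: j {IHm h1 h2} h => [|j]; case: m => [|m]; rewrite /= ?u_conjS => h;
    apply: (eq_trans _ (eq_trans h _)); ring.
have h1 := IHn j.+1 k m; have h2 := IHn j k.+1 m.
have h := congr2 (fun x y => I * y + x) h1 h2.
case: j {IHn h1 h2} h => [|j]; case: n => [|n]; case: m => [|m];
  rewrite /= ?uS => h; apply: (eq_trans _ (eq_trans h _)); ring.
Qed.

Lemma mixed_parts_im j k n m :
  k%:R * J j k.-1 n m + 'i%C * n%:R * J j k n.-1 m - 'i%C * m%:R * J j k n m.-1 =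
  2 * alpha%:C%C * J j k.+1 n m.
Proof.
have base j' k' : k'%:R * J j' k'.-1 0 0 = 2 * alpha%:C%C * J j' k'.+1 0 0.
  rewrite !mixed0.
  have : (2 * alpha * gauss_moment alpha k'.+1 * gauss_moment alpha j')%:C%C =
    (k'%:R * gauss_moment alpha k'.-1 * gauss_moment alpha j')%:C%C.
    by rewrite gauss_momentS.
  rewrite !rmorphM /= !rmorph_nat => h.
  apply: (eq_trans _ (eq_trans (esym h) _)); ring.
move: mixedS mixed_conjS base; move: (J) ('i%C) (alpha%:C%C) => u I a uS u_conjS base.
elim: n j k m => [|n IHn] j k m.
  elim: m j k => [|m IHm] j k; first by rewrite !mulr0 !mul0r subr0 addr0 base.
  have h1 := IHm j.+1 k; have h2 := IHm j k.+1.
  have h := congr2 (fun x y => - I * y + x) h1 h2.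
  case: k {IHm h1 h2} h => [|k]; case: m => [|m]; rewrite /= ?u_conjS => h;
    apply: (eq_trans _ (eq_trans h _)); ring.
have h1 := IHn j.+1 k m; have h2 := IHn j k.+1 m.
have h := congr2 (fun x y => I * y + x) h1 h2.
case: k {IHn h1 h2} h => [|k]; case: n => [|n]; case: m => [|m];
  rewrite /= ?uS => h; apply: (eq_trans _ (eq_trans h _)); ring.
Qed.

Lemma alphaC_neq0 : alpha%:C%C != 0 :> R[i].
Proof. by rewrite eq_complex /= gt_eqF. Qed.

(** Integration by parts for the Wirtinger derivative [(d/dx - i d/dy) / 2]: it lowers the power of
    [z], treats the conjugate as a constant, and brings [- alpha] times the conjugate of [z] out of
    the weight. *)
Lemma mixed00_conjS n m : alpha%:C%C * J 0 0 n m.+1 = n%:R * J 0 0 n.-1 m.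
Proof.
have two : (2 : R[i]) != 0 by rewrite pnatr_eq0.
apply: (mulfI two); rewrite mixed_conjS.
have h1 := mixed_parts_re 0 0 n m; have h2 := mixed_parts_im 0 0 n m.
have h := congr2 (fun u v => - 'i%C * v + u) h1 h2.
apply: (eq_trans (eq_trans _ (esym h))); first by ring.
have i2 : 'i%C * 'i%C = -1 :> R[i] by rewrite -expr2 sqr_i.
rewrite /= (_ : - 'i%C * _ + _ =
  (1 - 'i%C * 'i%C) * (n%:R * J 0 0 n.-1 m) + (1 + 'i%C * 'i%C) * (m%:R * J 0 0 n m.-1)).
  by rewrite i2; ring.
by ring.
Qed.

(** The same with the conjugate derivative [(d/dx + i d/dy) / 2], which exchanges the roles of [z]
    and its conjugate. *)
Lemma mixed00S n m : alpha%:C%C * J 0 0 n.+1 m = m%:R * J 0 0 n m.-1.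
Proof.
have two : (2 : R[i]) != 0 by rewrite pnatr_eq0.
apply: (mulfI two); rewrite mixedS.
have h1 := mixed_parts_re 0 0 n m; have h2 := mixed_parts_im 0 0 n m.
have h := congr2 (fun u v => 'i%C * v + u) h1 h2.
apply: (eq_trans (eq_trans _ (esym h))); first by ring.
have i2 : 'i%C * 'i%C = -1 :> R[i] by rewrite -expr2 sqr_i.
rewrite /= (_ : 'i%C * _ + _ =
  (1 + 'i%C * 'i%C) * (n%:R * J 0 0 n.-1 m) + (1 - 'i%C * 'i%C) * (m%:R * J 0 0 n m.-1)).
  by rewrite i2; ring.
by ring.
Qed.

(** The recursion lowers both exponents together; if they differ, one reaches 0 first and its
    coefficient kills the integral. *)
Lemma mixed00 n m : J 0 0 n m = if n == m then (n`!%:R / alpha ^+ n)%:C%C else 0.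
Proof.
elim: n m => [|n IHn] [|m].
- by rewrite mixed0 gauss_moment0// mulr1 fact0 expr0 divr1.
- by apply: (mulfI alphaC_neq0); rewrite mixed00_conjS mul0r mulr0.
- by apply: (mulfI alphaC_neq0); rewrite mixed00S mul0r mulr0.
apply: (mulfI alphaC_neq0); rewrite mixed00_conjS /= IHn eqSS.
case: eqVneq => _; last by rewrite !mulr0.
rewrite -(rmorph_nat (real_complex R)) -!rmorphM /=; congr (_%:C)%C.
by rewrite factS natrM exprS; field; rewrite expf_neq0 ?gt_eqF.
Qed.

Lemma inner_fock_monomial n m :
  inner alpha (fock_monomial alpha n) (fock_monomial alpha m) = (n == m)%:R.
Proof.
pose s k : R := Num.sqrt (alpha ^+ k / k`!%:R).
rewrite innerE (_ : (fun z => _) =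
  (fun z => (s n * s m)%:C%C * mixed_monomial 0 0 n m z + 0)); last first.
  apply/funext => z; rewrite /fock_monomial /mixed_monomial !expr0 mulr1 mul1r addr0.
  rewrite conjcM conjc_real -/(s n) -/(s m) rmorphM /=.
  by rewrite -[(z ^+ m)^*%C]/(conjc (z ^+ m)) (rmorphXn (@conjc R)); ring.
rewrite cint_lin; [|exact: cintegrable_mixed|exact: cintegrable0].
rewrite cint0 addr0 -/(J 0 0 n m) mixed00.
have [->|_] := eqVneq n m; last by rewrite mulr0.
rewrite -rmorphM -expr2 sqr_sqrtr; last by rewrite divr_ge0// exprn_ge0// ltW.
rewrite /= -[X in (_ * X)%:C%C]invf_div mulfV//.
by rewrite mulf_neq0 ?invr_eq0 ?expf_neq0 ?gt_eqF// ltr0n fact_gt0.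
Qed.
End monomial_integrals.

(** * The Gaussian L^2 space *)

Section L2_algebra.
Context {R : realType}.
Implicit Types (f g h : R[i] -> R[i]) (c : R[i]).
Local Notation area := (@lebesgue_measure R \x @lebesgue_measure R)%E.
Local Notation normc := ComplexField.Normc.normc.
Local Notation Re := complex.Re.
Local Notation Im := complex.Im.
Variable alpha : R.
Hypothesis alpha0 : 0 < alpha.
Local Notation wt p := (gauss_weight alpha (cxy p)).
Local Notation L2 := (@L2 R alpha).
Local Notation inner := (@inner R alpha).
Local Notation sqnorm := (@sqnorm R alpha).

Lemma cmeasurableM f g : cmeasurable f -> cmeasurable g ->
  cmeasurable (fun z => f z * g z).
Proof.
move=> [rf jf] [rg jg]; split.
- under eq_fun do rewrite ReM.
  by apply: measurable_funB; exact: measurable_funM.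
- under eq_fun do rewrite ImM.
  by apply: measurable_funD; exact: measurable_funM.
Qed.

Lemma cmeasurableD f g : cmeasurable f -> cmeasurable g ->
  cmeasurable (fun z => f z + g z).
Proof.
move=> [rf jf] [rg jg]; split.
- by under eq_fun do rewrite ReD; exact: measurable_funD.
- by under eq_fun do rewrite ImD; exact: measurable_funD.
Qed.

Lemma cmeasurable_cst c : cmeasurable (fun=> c : R[i]).
Proof. by split; exact: measurable_cst. Qed.

Lemma cmeasurable_conj f : cmeasurable f -> cmeasurable (fun z => (f z)^*%C).
Proof.
move=> [rf jf]; split; first by under eq_fun do rewrite Re_conj.
by under eq_fun do rewrite Im_conj; exact: measurableT_comp.
Qed.

Lemma cmeasurable_exp n : cmeasurable (fun z : R[i] => z ^+ n).
Proof.
have cid : cmeasurable (fun z : R[i] => z).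
  by split; [exact: measurable_fst|exact: measurable_snd].
elim: n => [|n IHn].
  by under eq_fun do rewrite expr0; exact: cmeasurable_cst.
by under eq_fun do rewrite exprS; exact: cmeasurableM.
Qed.

Lemma measurable_sqnorm_integrand f : cmeasurable f ->
  measurable_fun [set: measurableTypeR R * measurableTypeR R]
    (fun p => normc (f (cxy p)) ^+ 2 * wt p : measurableTypeR R).
Proof.
move=> [rf jf]; under eq_fun do rewrite sqr_normc.
apply: measurable_funM; last exact: measurable_gauss_weight.
by apply: measurable_funD; exact: measurable_funX.
Qed.

Lemma sqnorm_integrand_ge0 f p : 0 <= normc (f (cxy p)) ^+ 2 * wt p.
Proof. by rewrite mulr_ge0 ?sqr_ge0// ltW// gauss_weight_gt0. Qed.

Lemma sqnorm_ge0 f : (0 <= sqnorm f)%E.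
Proof. by apply: integral_ge0 => p _; rewrite lee_fin sqnorm_integrand_ge0. Qed.

Lemma L2_integrable f : L2 f ->
  area.-integrable setT (fun p => (normc (f (cxy p)) ^+ 2 * wt p)%:E).
Proof.
move=> [mf foo]; apply/integrableP; split.
  by apply/measurable_EFinP; exact: measurable_sqnorm_integrand.
apply: le_lt_trans foo; rewrite le_eqVlt; apply/orP; left; apply/eqP.
by apply: eq_integral => p _; rewrite gee0_abs// lee_fin sqnorm_integrand_ge0.
Qed.

Lemma integrable_L2 f : cmeasurable f ->
  area.-integrable setT (fun p => (normc (f (cxy p)) ^+ 2 * wt p)%:E) -> L2 f.
Proof.
move=> mf /integrableP[_ foo]; split => //; apply: le_lt_trans foo.
rewrite le_eqVlt; apply/orP; left; apply/eqP.
by apply: eq_integral => p _; rewrite gee0_abs// lee_fin sqnorm_integrand_ge0.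
Qed.

(** Pointwise, [|c f + g|^2 <= 2 |c|^2 |f|^2 + 2 |g|^2]. *)
Lemma L2_lin c f g : L2 f -> L2 g -> L2 (fun z => c * f z + g z).
Proof.
move=> Lf Lg; have mf := Lf.1; have mg := Lg.1.
have m : cmeasurable (fun z => c * f z + g z).
  by apply: cmeasurableD => //; apply: cmeasurableM => //; exact: cmeasurable_cst.
apply: (integrable_L2 m).
apply: (@le_integrable _ _ _ area setT measurableT _ (fun p =>
  (2 * normc c ^+ 2)%:E * (normc (f (cxy p)) ^+ 2 * wt p)%:E +
  2%:E * (normc (g (cxy p)) ^+ 2 * wt p)%:E)%E).
- by apply/measurable_EFinP; exact: (measurable_sqnorm_integrand m).
- move=> p _; rewrite -!EFinM -EFinD /= lee_fin
    (ger0_norm (sqnorm_integrand_ge0 (fun z => c * f z + g z) p)).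
  apply: le_trans (ler_norm _).
  rewrite (_ : _ + _ = (2 * (normc c ^+ 2 * normc (f (cxy p)) ^+ 2)
    + 2 * normc (g (cxy p)) ^+ 2) * wt p); last by ring.
  apply: ler_wpM2r; first by rewrite ltW// gauss_weight_gt0.
  rewrite -sqr_normcM !sqr_normc ReD ImD.
  have := sqr_ge0 (Re (c * f (cxy p)) - Re (g (cxy p))).
  by have := sqr_ge0 (Im (c * f (cxy p)) - Im (g (cxy p))); nra.
- exact: (integrableD measurableT (integrableZl measurableT _ (L2_integrable Lf))
    (integrableZl measurableT _ (L2_integrable Lg))).
Qed.

(** Pointwise, the real and imaginary parts of the product are bounded by [|f|^2 + |g|^2]. *)
Lemma cintegrable_L2M f g : L2 f -> L2 g -> cintegrable alpha (fun z => f z * (g z)^*%C).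
Proof.
move=> Lf Lg; have mf := Lf.1; have mg := Lg.1.
have [mr mi] : cmeasurable (fun z => f z * (g z)^*%C).
  by apply: cmeasurableM => //; exact: cmeasurable_conj.
have idom : area.-integrable setT (fun p =>
  ((normc (f (cxy p)) ^+ 2 * wt p)%:E + (normc (g (cxy p)) ^+ 2 * wt p)%:E)%E).
  by apply: (integrableD measurableT); exact: L2_integrable.
split; apply: (le_integrable measurableT _ _ idom).
- by apply/measurable_EFinP/measurable_funM => //; exact: measurable_gauss_weight.
- move=> p _; rewrite -EFinD /= lee_fin; apply: le_trans (ler_norm _).
  rewrite -mulrDl normrM (gtr0_norm (gauss_weight_gt0 alpha0 _)).
  apply: ler_wpM2r; first by rewrite ltW// gauss_weight_gt0.
  rewrite !sqr_normc ReM Re_conj Im_conj ler_norml.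
  set a := Re (f _); set b := Im (f _); set x := Re (g _); set y := Im (g _).
  have := sqr_ge0 (a - x); have := sqr_ge0 (a + x).
  have := sqr_ge0 (b - y); have := sqr_ge0 (b + y).
  have := sqr_ge0 a; have := sqr_ge0 b; have := sqr_ge0 x; have := sqr_ge0 y.
  by move=> *; apply/andP; split; nra.
- by apply/measurable_EFinP/measurable_funM => //; exact: measurable_gauss_weight.
- move=> p _; rewrite -EFinD /= lee_fin; apply: le_trans (ler_norm _).
  rewrite -mulrDl normrM (gtr0_norm (gauss_weight_gt0 alpha0 _)).
  apply: ler_wpM2r; first by rewrite ltW// gauss_weight_gt0.
  rewrite !sqr_normc ImM Re_conj Im_conj ler_norml.
  set a := Re (f _); set b := Im (f _); set x := Re (g _); set y := Im (g _).
  have := sqr_ge0 (a - y); have := sqr_ge0 (a + y).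
  have := sqr_ge0 (b - x); have := sqr_ge0 (b + x).
  have := sqr_ge0 a; have := sqr_ge0 b; have := sqr_ge0 x; have := sqr_ge0 y.
  by move=> *; apply/andP; split; nra.
Qed.

Lemma inner_linl c f g h : L2 f -> L2 g -> L2 h ->
  inner (fun z => c * f z + g z) h = c * inner f h + inner g h.
Proof.
move=> Lf Lg Lh; rewrite !innerE -cint_lin; try exact: cintegrable_L2M.
by congr cint; apply/funext => z; rewrite mulrDl mulrA.
Qed.

Lemma inner_conj f g : L2 f -> L2 g -> inner g f = (inner f g)^*%C.
Proof.
move=> Lf Lg; rewrite !innerE -cint_conj; last exact: cintegrable_L2M.
by congr cint; apply/funext => z; rewrite conjcM conjcK mulrC.
Qed.

Lemma inner_ae f g h : L2 f -> L2 g -> L2 h -> ae_equal f g ->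
  inner f h = inner g h.
Proof.
move=> Lf Lg Lh fg; rewrite !innerE; apply: cint_ae => //.
- by apply: cmeasurableM; [exact: Lf.1|apply/cmeasurable_conj/Lh.1].
- by apply: cmeasurableM; [exact: Lg.1|apply/cmeasurable_conj/Lh.1].
case: fg => N [mN N0 sub]; exists N; split => // p np; apply: sub => /= E.
exact: (np (congr1 (fun x => x * (h (cxy p))^*%C) E)).
Qed.

(** A real-valued counterpart of the extended real [sqnorm], which lets [ring] and [lra] handle norm
    identities. *)
Definition nsq f : R := Re (inner f f).

Lemma sqnorm_nsq f : L2 f -> sqnorm f = (nsq f)%:E.
Proof.
move=> Lf; rewrite /nsq /= /Rintegral fineK.
  by apply: eq_integral => p _; rewrite mulc_conj.
exact: (integrable_fin_num measurableT (cintegrable_L2M Lf Lf).1).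
Qed.

Lemma nsq_ge0 f : L2 f -> 0 <= nsq f.
Proof. by move=> Lf; rewrite -lee_fin -sqnorm_nsq// sqnorm_ge0. Qed.

Lemma inner_nsq f : L2 f -> inner f f = (nsq f)%:C%C.
Proof.
move=> Lf; apply: complex_eq; first by [].
rewrite [RHS]/=.
have := congr1 (@complex.Im R) (inner_conj Lf Lf); rewrite Im_conj.
by move: (Im (inner f f)) => y; lra.
Qed.

Lemma L2_0 : L2 (fun=> 0).
Proof.
split; first exact: cmeasurable_cst.
rewrite /Defs.sqnorm (eq_integral (cst 0%E)) ?integral0 ?ltry//.
by move=> p _; rewrite sqr_normc /= expr0n addr0 mul0r.
Qed.

Lemma L2_B f g : L2 f -> L2 g -> L2 (fun z => f z - g z).
Proof.
move=> Lf Lg; rewrite (_ : (fun z => _) = fun z => -1 * g z + f z).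
  exact: L2_lin.
by apply/funext => z; rewrite mulN1r addrC.
Qed.

Lemma L2_Z c f : L2 f -> L2 (fun z => c * f z).
Proof.
move=> Lf; rewrite (_ : (fun z => _) = fun z => c * f z + 0).
  by apply: L2_lin => //; exact: L2_0.
by apply/funext => z; rewrite addr0.
Qed.

Lemma inner0l h : inner (fun=> 0) h = 0.
Proof.
by rewrite innerE -[RHS](cint0 alpha); congr cint; apply/funext => z; rewrite mul0r.
Qed.

Lemma innerBl f g h : L2 f -> L2 g -> L2 h ->
  inner (fun z => f z - g z) h = inner f h - inner g h.
Proof.
move=> Lf Lg Lh; rewrite (_ : (fun z => _) = fun z => -1 * g z + f z).
  by rewrite inner_linl// mulN1r addrC.
by apply/funext => z; rewrite mulN1r addrC.
Qed.

Lemma innerZl c f h : L2 f -> L2 h -> inner (fun z => c * f z) h = c * inner f h.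
Proof.
move=> Lf Lh; rewrite (_ : (fun z => _) = fun z => c * f z + 0).
  by rewrite inner_linl ?inner0l ?addr0//; exact: L2_0.
by apply/funext => z; rewrite addr0.
Qed.

Lemma innerBr f g h : L2 f -> L2 g -> L2 h ->
  inner h (fun z => f z - g z) = inner h f - inner h g.
Proof.
move=> Lf Lg Lh; rewrite (inner_conj (L2_B Lf Lg) Lh) innerBl//.
by rewrite (inner_conj Lf Lh) (inner_conj Lg Lh) rmorphB.
Qed.

Lemma nsqB f g : L2 f -> L2 g ->
  nsq (fun z => f z - g z) = nsq f + nsq g - 2 * Re (inner f g).
Proof.
move=> Lf Lg; have LB := L2_B Lf Lg.
rewrite /nsq innerBl// !innerBr// (inner_conj Lf Lg).
by rewrite !(ReD, ReN, Re_conj); ring.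
Qed.

(** The parallelogram law for [h - f] and [h - g], without the squared norm of their sum. It
    compares two Fourier sums through a common refinement [h]. *)
Lemma nsqB_le f g h : L2 f -> L2 g -> L2 h ->
  nsq (fun z => f z - g z) <=
  2 * nsq (fun z => h z - f z) + 2 * nsq (fun z => h z - g z).
Proof.
move=> Lf Lg Lh; have L1 := L2_B Lh Lf; have L2' := L2_B Lh Lg.
have E : (fun z => f z - g z) = (fun z => (h z - g z) - (h z - f z)).
  by apply/funext => z; ring.
have := nsq_ge0 (L2_lin 1 L1 L2').
have F : nsq (fun z => 1 * (h z - f z) + (h z - g z)) =
   nsq (fun z => h z - g z) + nsq (fun z => h z - f z)
   + 2 * Re (inner (fun z => h z - g z) (fun z => h z - f z)).
  have L3 := L2_lin 1 L1 L2'.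
  rewrite /nsq inner_linl// mul1r (inner_conj L3 L1) (inner_conj L3 L2') !inner_linl// !mul1r.
  rewrite (inner_conj L2' L1) !(ReD, Re_conj); ring.
by rewrite F E (nsqB L2' L1); lra.
Qed.

Lemma nsq_pythagoras f g : L2 f -> L2 g -> inner f g = 0 ->
  nsq (fun z => f z - g z) = nsq f + nsq g.
Proof. by move=> Lf Lg fg; rewrite nsqB// fg mulr0 subr0. Qed.

Lemma nsqZ c f : L2 f -> nsq (fun z => c * f z) = normc c ^+ 2 * nsq f.
Proof.
move=> Lf; have Lc := L2_Z c Lf.
rewrite /nsq innerZl// (inner_conj Lc Lf) innerZl// (inner_nsq Lf) conjcM.
by rewrite mulrA mulc_conj conjc_real -rmorphM.
Qed.

Definition lincomb (I : Type) (s : seq I) (c : I -> R[i]) (v : I -> R[i] -> R[i]) :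
  R[i] -> R[i] := fun z => \sum_(i <- s) c i * v i z.

Lemma L2_lincomb (I : eqType) (s : seq I) (c : I -> R[i]) v : {in s, forall i, L2 (v i)} ->
  L2 (lincomb s c v).
Proof.
rewrite /lincomb; elim: s => [|i s IHs] Lv.
  by under eq_fun do rewrite big_nil; exact: L2_0.
under eq_fun do rewrite big_cons.
apply: L2_lin; first by apply: Lv; rewrite inE eqxx.
by apply: IHs => j js; apply: Lv; rewrite inE js orbT.
Qed.

Lemma inner_lincombl (I : eqType) (s : seq I) (c : I -> R[i]) v h :
  {in s, forall i, L2 (v i)} -> L2 h ->
  inner (lincomb s c v) h = \sum_(i <- s) c i * inner (v i) h.
Proof.
rewrite /lincomb => + Lh; elim: s => [|i s IHs] Lv.
  by under eq_fun do rewrite big_nil; rewrite inner0l big_nil.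
under eq_fun do rewrite big_cons.
have Ls : {in s, forall i, L2 (v i)}.
  by move=> j js; apply: Lv; rewrite inE js orbT.
rewrite inner_linl ?IHs ?big_cons//; last exact: L2_lincomb.
by apply: Lv; rewrite inE eqxx.
Qed.

(** The index type is free because two kinds of families occur: basis elements indexed by themselves
    through [id], and monomials indexed by their degree. *)
Definition orthonormal (I : eqType) (s : seq I) (v : I -> R[i] -> R[i]) :=
  [/\ uniq s, {in s, forall i, L2 (v i)} &
      {in s &, forall i j, inner (v i) (v j) = (i == j)%:R}].

Definition fourier (I : Type) (s : seq I) (v : I -> R[i] -> R[i]) f :=
  lincomb s (fun i => inner f (v i)) v.

Lemma L2_fourier (I : eqType) (s : seq I) v f : orthonormal s v -> L2 (fourier s v f).
Proof. by case=> _ Lv _; exact: L2_lincomb. Qed.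

Lemma inner_fourier (I : eqType) (s : seq I) v f : orthonormal s v ->
  {in s, forall i, inner (fourier s v f) (v i) = inner f (v i)}.
Proof.
move=> [us Lv ov] i si; rewrite inner_lincombl//; last exact: Lv.
rewrite (bigD1_seq i)//= ov// eqxx mulr1 big_seq_cond big1 ?addr0// => j /andP[js ji].
by rewrite ov// (negbTE ji) mulr0.
Qed.

Lemma nsq_fourier (I : eqType) (s : seq I) v f : orthonormal s v -> L2 f ->
  Re (inner (fourier s v f) f) = \sum_(i <- s) normc (inner f (v i)) ^+ 2 /\
  nsq (fourier s v f) = \sum_(i <- s) normc (inner f (v i)) ^+ 2.
Proof.
move=> os Lf; have [us Lv ov] := os; have Lp := L2_fourier f os.
have ReS (F : I -> R[i]) : Re (\sum_(i <- s) F i) = \sum_(i <- s) Re (F i).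
  by elim/big_ind2 : _ => //= a b c d <- <-; rewrite ReD.
(* Stated for every [g] with the same coefficients as [f]: the choices [g = f] and [g] the Fourier
   sum give the two equalities. *)
have h (g : R[i] -> R[i]) : L2 g -> {in s, forall i, inner g (v i) = inner f (v i)} ->
   Re (inner (fourier s v f) g) = \sum_(i <- s) normc (inner f (v i)) ^+ 2.
  move=> Lg gf; rewrite inner_lincombl// ReS big_seq [RHS]big_seq.
  apply: eq_bigr => i si; rewrite (inner_conj Lg); last exact: Lv.
  by rewrite gf// mulc_conj.
by split; [exact: h|apply: h => //; exact: inner_fourier].
Qed.

Lemma nsq_sub_fourier (I : eqType) (s : seq I) v f : orthonormal s v -> L2 f ->
  nsq (fun z => f z - fourier s v f z) =
  nsq f - \sum_(i <- s) normc (inner f (v i)) ^+ 2.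
Proof.
move=> os Lf; have Lp := L2_fourier f os; have [h1 h2] := nsq_fourier os Lf.
by rewrite nsqB// (inner_conj Lp Lf) Re_conj h1 h2; ring.
Qed.

Lemma bessel (I : eqType) (s : seq I) v f : orthonormal s v -> L2 f ->
  \sum_(i <- s) normc (inner f (v i)) ^+ 2 <= nsq f.
Proof.
move=> os Lf; rewrite -subr_ge0 -nsq_sub_fourier//; apply: nsq_ge0.
by apply: L2_B => //; exact: L2_fourier.
Qed.

(** Cauchy-Schwarz against a unit vector, as Bessel's inequality for a family with one member. *)
Lemma normc_inner_le f g : L2 f -> L2 g -> inner g g = 1 ->
  normc (inner f g) ^+ 2 <= nsq f.
Proof.
move=> Lf Lg g1; have := @bessel _ [:: tt] (fun=> g) f.
rewrite big_seq1; apply => //; split => // -[] []//.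
Qed.
End L2_algebra.

(** * Completeness of the Gaussian L^2 space *)

Section riesz_fischer.
Context d (T : measurableType d) {R : realType}.
Variable mu : {measure set T -> \bar R}.

Lemma limn_einf_le (u : (\bar R)^nat) (c : \bar R) :
  (forall n, u n <= c)%E -> (limn_einf u <= c)%E.
Proof.
move=> uc; rewrite limn_einf_lim; apply: lime_le; first exact: is_cvg_einfs.
apply: nearW => n; apply: le_trans (uc n).
by apply: ereal_inf_lbound; exists n => /=.
Qed.

Lemma geometric_increments_cvg (w : R^nat) (K : R) :
  (forall n, `|w n.+1 - w n| <= K / 2 ^+ n) -> cvgn w.
Proof.
move=> wK.
have K0 : 0 <= K by have := wK 0%N; rewrite expr0 divr1; apply: le_trans.
have cs : cvgn [normed series (telescope w)].
  apply: (@series_le_cvg _ _ (geometric K 2^-1)) => [n|n|n|].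
  - exact: normr_ge0.
  - by rewrite /= mulr_ge0// exprn_ge0.
  - by rewrite /= /telescope exprVn; exact: wK.
  - by apply: is_cvg_geometric_series; rewrite ger0_norm// invf_lt1// ltr1n.
have {}cs := normed_cvg cs.
rewrite (_ : w = (fun n => w 0%N + series (telescope w) n)).
  by apply: is_cvgD => //; exact: is_cvg_cst.
by apply/funext => n; exact: eq_sum_telescope.
Qed.

Lemma sum_quarter_le (C : R) (n : nat) : 0 <= C ->
  \sum_(0 <= k < n) (2 * C / 4 ^+ k) <= 4 * C.
Proof.
(* The subtracted term [4 * C / 4 ^+ n] strengthens the bound so that the induction closes. *)
move=> C0; suff h : \sum_(0 <= k < n) (2 * C / 4 ^+ k) <= 4 * C - 4 * C / 4 ^+ n.
  by apply: (le_trans h); rewrite lerBlDr lerDl divr_ge0// ?mulr_ge0// exprn_ge0.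
elim: n => [|n IHn]; first by rewrite big_nil expr0; lra.
rewrite big_nat_recr//=; apply: (le_trans (lerD IHn (lexx _))).
have q0 : 0 <= (4 ^+ n)^-1 :> R by rewrite invr_ge0 exprn_ge0.
have -> : (4 ^+ n.+1)^-1 = 4^-1 * (4 ^+ n)^-1 :> R by rewrite exprS invfM.
by have := mulr_ge0 C0 q0; set q := (4 ^+ n)^-1; nra.
Qed.

(** The rate [16 ^- n] for squared norms leaves room for the weights [4 ^+ n] in [D]: the weighted
    increments still have summable integrals, and finiteness of their sum at a point forces
    increments of order [2 ^- n] there. *)
Lemma L2_geometric_cauchy (u : nat -> T -> R) (C : R) : 0 <= C ->
  (forall n, measurable_fun setT (u n)) ->
  (forall n m, \int[mu]_x ((u n x - u m x) ^+ 2)%:E <= (C / 16 ^+ n + C / 16 ^+ m)%:E)%E ->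
  exists2 v : T -> R, measurable_fun setT v &
    forall n, (\int[mu]_x ((u n x - v x) ^+ 2)%:E <= (2 * C / 16 ^+ n)%:E)%E.
Proof.
move=> C0 mfu uC.
have msub n (v : T -> R) : measurable_fun setT v ->
    measurable_fun setT (fun x => ((u n x - v x) ^+ 2)%:E).
  move=> mv; apply/measurable_EFinP; apply: measurable_funX.
  exact: measurable_funB.
pose D n x := ((4 ^+ n)%:E * ((u n.+1 x - u n x) ^+ 2)%:E)%E.
have D0 n x : (0 <= D n x)%E.
  by rewrite /D -EFinM lee_fin mulr_ge0 ?sqr_ge0// exprn_ge0.
have mD n : measurable_fun setT (D n).
  by apply: measurable_funeM; exact: msub.
pose G x := (\sum_(0 <= n <oo) D n x)%E.
have mG : measurable_fun setT G.
  by apply: (@ge0_emeasurable_sum _ _ _ setT D xpredT) => // k x _ _.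
have intG : (\int[mu]_x G x <= (4 * C)%:E)%E.
  rewrite /G integral_nneseries//.
  have step n : (\int[mu]_x D n x <= (2 * C / 4 ^+ n)%:E)%E.
    have p4 : (0 <= (4 ^+ n)%:E :> \bar R)%E by rewrite lee_fin exprn_ge0.
    have sq x : setT x -> (0 <= ((u n.+1 x - u n x) ^+ 2)%:E)%E.
      by move=> _; rewrite lee_fin sqr_ge0.
    rewrite /D (ge0_integralZl mu measurableT (msub n.+1 _ (mfu n)) sq p4).
    apply: (le_trans (lee_wpmul2l p4 (uC n.+1 n))).
    rewrite -EFinM lee_fin.
    have -> : (16 : R) = 4 * 4 by ring.
    rewrite !exprMn !exprS.
    have q0 : (4 ^+ n : R) != 0 by rewrite expf_neq0.
    have -> : 4 ^+ n * (C / (4 * 4 ^+ n * (4 * 4 ^+ n)) + C / (4 ^+ n * 4 ^+ n)) =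
      (17 / 16) * C / 4 ^+ n :> R by field; rewrite q0.
    rewrite ler_pM2r ?invr_gt0 ?exprn_gt0//; lra.
  apply: lime_le.
    by apply: is_cvg_nneseries => n _ _; apply: integral_ge0 => x _; exact: D0.
  apply: nearW => n.
  have le1 : (\sum_(0 <= k < n) \int[mu]_x D k x <=
      \sum_(0 <= k < n) (2 * C / 4 ^+ k)%:E)%E.
    by apply: lee_sum => k _; exact: step.
  by apply: (le_trans le1); rewrite sumEFin lee_fin sum_quarter_le.
have G0 x : (0 <= G x)%E by apply: nneseries_ge0.
have iG : mu.-integrable setT G.
  apply/integrableP; split => //; apply: le_lt_trans (ltry (4 * C)).
  by apply: le_trans intG; apply: ge0_le_integral => //;
    [exact: measurableT_comp|move=> x _; rewrite gee0_abs].
(* An upper limit is measurable everywhere. It is the limit of [u n x] wherever [G x] is finite,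
   which is almost everywhere, and its values elsewhere do not affect the integrals. *)
pose v x := fine (limn_esup (fun n => (u n x)%:E)).
have mv : measurable_fun setT v.
  apply: measurableT_comp => //; apply: measurable_fun_limn_esup => n.
  exact/measurable_EFinP.
have cvgu x : G x \is a fin_num -> (fun n => u n x) @ \oo --> v x.
  move=> Gfin.
  (* A single term of [G] gives [(u n.+1 x - u n x) ^+ 2 <= G x / 4 ^+ n]; as [G <= (G + 1) ^+ 2],
     the bound [G + 1] stands in for the square root. *)
  have inc n : `|u n.+1 x - u n x| <= (fine (G x) + 1) / 2 ^+ n.
    have DG : (D n x <= G x)%E.
      have := @nneseries_lim_ge _ (D ^~ x) xpredT 0%N n.+1 (fun n _ _ => D0 n x).
      rewrite big_nat_recr//=; apply: le_trans; rewrite leeDr//.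
      by apply: sume_ge0.
    move: DG; rewrite /D -EFinM -[G x]fineK// lee_fin => h.
    have g0 : 0 <= fine (G x) by rewrite fine_ge0.
    rewrite ler_pdivlMr ?exprn_gt0// mulrC.
    rewrite -(@ler_pXn2r _ 2) ?nnegrE ?mulr_ge0 ?exprn_ge0 ?addr_ge0//.
    rewrite exprMn real_normK ?num_real// -exprM mulnC exprM.
    have -> : (2 : R) ^+ 2 = 4 by ring.
    apply: (le_trans h); nra.
  have /cvg_ex[l ul] := geometric_increments_cvg inc.
  have lE : limn_esup (fun n => (u n x)%:E) = l%:E.
    have ule : (fun n => (u n x)%:E) @ \oo --> l%:E.
      by apply: cvg_EFin; [exact: nearW|exact: ul].
    by have [_ ->] := cvg_limn_einf_sup ule.
  by rewrite /v lE.
exists v => // n.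
(* Fatou's lemma in [m]: the [g m] tend to [(u n - v) ^+ 2] almost everywhere, and their integrals
   are at most [C / 16 ^+ n + C / 16 ^+ (n + m)]. *)
pose g m x := ((u n x - u (n + m)%N x) ^+ 2)%:E.
have gle m : (\int[mu]_x g m x <= (2 * C / 16 ^+ n)%:E)%E.
  apply: (le_trans (uC n (n + m)%N)); rewrite lee_fin mulr2n mulrDl !mul1r mulrDl lerD2l.
  by rewrite ler_wpM2l// lef_pV2 ?posrE ?exprn_gt0// ler_eXn2l ?leq_addr// ltr1n.
apply: le_trans (limn_einf_le gle).
apply: le_trans (fatou mu measurableT _ _); last 2 first.
- by move=> m; exact: msub.
- by move=> m x _; rewrite lee_fin sqr_ge0.
rewrite le_eqVlt; apply/orP; left; apply/eqP; apply: ae_eq_integral => //.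
- exact: msub.
- rewrite (_ : (fun x => _) = (fun x => - limn_esup (fun m => - g m x))%E)//.
  apply: measurableT_comp => //; apply: measurable_fun_limn_esup => m.
  by apply: measurableT_comp => //; exact: msub.
have := integrable_ae measurableT iG; apply: filterS => x + _ => /(_ I) Gfin.
have cg : (fun m => g m x) @ \oo --> ((u n x - v x) ^+ 2)%:E.
  apply: cvg_EFin; first exact: nearW.
  apply: (cvg_comp (fun m => u n x - u (n + m)%N x) (fun y : R => y ^+ 2)); last first.
    exact: exprn_continuous.
  apply: cvgB; first exact: cvg_cst.
  have := cvgu x Gfin; rewrite -(cvg_shiftn n) => h.
  by under eq_fun do rewrite addnC; exact: h.
by have [-> _] := cvg_limn_einf_sup cg.
Qed.
End riesz_fischer.

Section L2_complete.
Context {R : realType}.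
Local Notation area := (@lebesgue_measure R \x @lebesgue_measure R)%E.
Local Notation normc := ComplexField.Normc.normc.
Local Notation Re := complex.Re.
Local Notation Im := complex.Im.
Variable alpha : R.
Hypothesis alpha0 : 0 < alpha.
Local Notation wt p := (gauss_weight alpha (cxy p)).

Lemma fock_L2_complete (f : nat -> R[i] -> R[i]) (C : R) : 0 <= C ->
  (forall n, L2 alpha (f n)) ->
  (forall n m, (sqnorm alpha (fun z => f n z - f m z)%R <=
    (C / 16 ^+ n + C / 16 ^+ m)%:E)%E) ->
  exists2 s, L2 alpha s &
    forall n, (sqnorm alpha (fun z => f n z - s z)%R <= (4 * C / 16 ^+ n)%:E)%E.
Proof.
move=> C0 Lf fC.
(* Multiplication by the square root of the weight carries the Gaussian space into [L^2] of the area
   measure. Written with [powR], the root and its inverse are measurable for the same reason. *)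
pose rt (p : measurableTypeR R * measurableTypeR R) : R := wt p `^ 2^-1.
have rt2 p : rt p ^+ 2 = wt p.
  by rewrite /rt powR12_sqrt ?sqr_sqrtr// ltW// gauss_weight_gt0.
have rt0 p : 0 < rt p by rewrite powR_gt0// gauss_weight_gt0.
have mw := measurable_gauss_weight alpha0.
have mrt : measurable_fun setT rt.
  exact: (measurableT_comp (measurable_powR 2^-1) mw).
have mrtV : measurable_fun setT (fun p => (rt p)^-1).
  rewrite (_ : (fun p => _) = (fun p => wt p `^ (- 2^-1))).
    exact: (measurableT_comp (measurable_powR (- 2^-1)) mw).
  by apply/funext => p; rewrite powRN.
have component (comp : R[i] -> R) :
    (forall n, measurable_fun [set: measurableTypeR R * measurableTypeR R]
       (fun p => comp (f n (cxy p)))) ->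
    (forall a b, (comp a - comp b) ^+ 2 <= normc (a - b) ^+ 2) ->
    exists2 v : measurableTypeR R * measurableTypeR R -> R, measurable_fun setT v &
      forall n, (\int[area]_p ((comp (f n (cxy p)) * rt p - v p) ^+ 2)%:E <=
         (2 * C / 16 ^+ n)%:E)%E.
  move=> mc cle.
  apply: (@L2_geometric_cauchy _ _ _ area (fun n p => comp (f n (cxy p)) * rt p) C C0).
    by move=> n; exact: measurable_funM.
  move=> n m; apply: le_trans (fC n m).
  have mnm : cmeasurable (fun z => f n z - f m z) := (L2_B alpha0 (Lf n) (Lf m)).1.
  apply: ge0_le_integral => //.
  - by move=> p _; rewrite lee_fin sqr_ge0.
  - apply/measurable_EFinP; apply: measurable_funX.
    by apply: measurable_funB; exact: measurable_funM.
  - by apply/measurable_EFinP; exact: (measurable_sqnorm_integrand alpha0 mnm).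
  - move=> p _; rewrite lee_fin -mulrBl exprMn rt2.
    by apply: ler_wpM2r; [rewrite ltW// gauss_weight_gt0|exact: cle].
have [vr mvr vrle] := component (@complex.Re R) (fun n => (Lf n).1.1) (fun a b =>
  ltac:(rewrite sqr_normc ReD ImD ReN ImN lerDl; exact: sqr_ge0)).
have [vi mvi vile] := component (@complex.Im R) (fun n => (Lf n).1.2) (fun a b =>
  ltac:(rewrite sqr_normc ReD ImD ReN ImN lerDr; exact: sqr_ge0)).
pose s (z : R[i]) : R[i] :=
  ((vr (Re z, Im z) / rt (Re z, Im z)) +i* (vi (Re z, Im z) / rt (Re z, Im z)))%C.
have sE p : s (cxy p) = ((vr p / rt p) +i* (vi p / rt p))%C by case: p.
have ms : cmeasurable s.
  split; under eq_fun do rewrite sE /=; exact: measurable_funM.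
have fs n : (sqnorm alpha (fun z => f n z - s z)%R <= (4 * C / 16 ^+ n)%:E)%E.
  have mrn := (Lf n).1.1; have min := (Lf n).1.2.
  rewrite /sqnorm (_ : (\int[_]_p _)%E = (\int[area]_p
    (((Re (f n (cxy p)) * rt p - vr p) ^+ 2)%:E +
     ((Im (f n (cxy p)) * rt p - vi p) ^+ 2)%:E))%E).
    rewrite ge0_integralD//.
    - apply: (le_trans (leeD (vrle n) (vile n))).
      by rewrite -EFinD lee_fin le_eqVlt; apply/orP; left; apply/eqP; ring.
    - by move=> p _; rewrite lee_fin sqr_ge0.
    - apply/measurable_EFinP; apply: measurable_funX.
      by apply: measurable_funB => //; exact: measurable_funM.
    - by move=> p _; rewrite lee_fin sqr_ge0.
    - apply/measurable_EFinP; apply: measurable_funX.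
      by apply: measurable_funB => //; exact: measurable_funM.
  apply: eq_integral => p _; rewrite -EFinD sE sqr_normc ReD ImD ReN ImN -rt2 /=.
  by congr EFin; field; rewrite gt_eqF.
exists s => //.
(* The limit [s] is in [L2] as the difference of [f 0] and [f 0 - s]. *)
have L0 : L2 alpha (fun z => f 0%N z - s z).
  split; last exact: le_lt_trans (fs 0%N) (ltry _).
  rewrite (_ : (fun z => _) = (fun z => f 0%N z + (-1) * s z)).
    apply: cmeasurableD; first exact: (Lf 0%N).1.
    by apply: cmeasurableM => //; exact: cmeasurable_cst.
  by apply/funext => z; rewrite mulN1r.
rewrite (_ : s = (fun z => f 0%N z - (f 0%N z - s z))).
  exact: L2_B.
by apply/funext => z; rewrite subKr.
Qed.
End L2_complete.

(** * Orthonormal bases of the Fock space *)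

Lemma le0_geometric_bound (R : realType) (x k : R) :
  (forall n, x <= k / 16 ^+ n) -> x <= 0.
Proof.
move=> xk; rewrite leNgt; apply/negP => x0.
have k0 : 0 <= k by have := xk 0%N; rewrite expr0 divr1; apply: le_trans; exact: ltW.
have kx0 : 0 <= k / x by rewrite divr_ge0// ltW.
have := archi_boundP kx0; set n := Num.bound _ => hn.
have := xk n; rewrite ler_pdivlMr ?exprn_gt0// leNgt => /negP; apply.
rewrite mulrC -ltr_pdivrMr//; apply: (lt_le_trans hn).
by rewrite -natrX ler_nat ltnW// ltn_expl.
Qed.

Lemma fock_lin (R : realType) (alpha : R) (c : R[i]) (f g : R[i] -> R[i]) :
  0 < alpha -> fock alpha f -> fock alpha g -> fock alpha (fun z => c * f z + g z).
Proof.
move=> alpha0 [ef Lf] [eg Lg]; split; last exact: L2_lin.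
move=> z; exact: (derivableD (@derivableZ _ _ _ _ c _ _ (ef z)) (eg z)).
Qed.

Lemma fock_0 (R : realType) (alpha : R) : fock alpha (fun=> 0 : R[i]).
Proof. split; [move=> z; exact: derivable_cst|exact: L2_0]. Qed.

Lemma fock_B (R : realType) (alpha : R) (f g : R[i] -> R[i]) : 0 < alpha ->
  fock alpha f -> fock alpha g -> fock alpha (fun z => f z - g z).
Proof.
move=> alpha0 Ff Fg; rewrite (_ : (fun z => _) = (fun z => -1 * g z + f z)).
  exact: fock_lin.
by apply/funext => z; rewrite mulN1r addrC.
Qed.

Lemma fock_lincomb (R : realType) (alpha : R) (I : eqType) (s : seq I)
    (c : I -> R[i]) (v : I -> R[i] -> R[i]) : 0 < alpha ->
  {in s, forall i, fock alpha (v i)} -> fock alpha (lincomb s c v).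
Proof.
rewrite /lincomb => alpha0; elim: s => [|i s IHs] Fv.
  by under eq_fun do rewrite big_nil; exact: fock_0.
under eq_fun do rewrite big_cons.
apply: fock_lin => //; first by apply: Fv; rewrite inE eqxx.
by apply: IHs => j js; apply: Fv; rewrite inE js orbT.
Qed.

(** Up to a constant, [|e_n|^2] is the mixed monomial with exponents [0, 0, n, n], whose
    integrability is known. *)
Lemma fock_fock_monomial (R : realType) (alpha : R) (n : nat) : 0 < alpha ->
  fock alpha (fock_monomial alpha n).
Proof.
move=> alpha0; split.
  move=> z; exact: (@derivableZ _ _ _ _ (Num.sqrt (alpha ^+ n / n`!%:R))%:C%C _ _
    (@exprn_derivable _ n z 1)).
have me : cmeasurable (fock_monomial alpha n).
  by apply: cmeasurableM; [exact: cmeasurable_cst|exact: cmeasurable_exp].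
apply: integrable_L2 => //.
pose s : R := Num.sqrt (alpha ^+ n / n`!%:R).
have := (cintegrable_lin (s ^+ 2)%:C%C (cintegrable_mixed alpha0 0 0 n n)
   (@cintegrable0 _ alpha)).1.
congr (_.-integrable _ _); apply/funext => p.
congr ((_ * _)%:E); rewrite addr0 /mixed_monomial !expr0 mulr1 mul1r.
rewrite -[(cxy p)^*%C ^+ n](rmorphXn (@conjc R)) /= mulc_conj -rmorphM /=.
rewrite /fock_monomial sqr_normcM -/s [in RHS]sqr_normc /=.
by rewrite expr0n addr0.
Qed.

Section basis_approximation.
Context {R : realType}.
Local Notation normc := ComplexField.Normc.normc.
Local Notation Re := complex.Re.
Local Notation Im := complex.Im.
Variables (alpha : R) (P : (R[i] -> R[i]) -> R[i] -> R[i]) (B : set (R[i] -> R[i])).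
Hypothesis alpha0 : 0 < alpha.
Hypothesis projP : fock_projection alpha P.
Hypothesis basisB : fock_orthonormal_basis alpha B.
Local Notation inner := (inner alpha).
Local Notation nsq := (nsq alpha).
Implicit Types (F G : seq (R[i] -> R[i])) (e : R[i] -> R[i]).

Definition basis_seq F := uniq F /\ {in F, forall b, B b}.

Lemma basis_seq_orthonormal F : basis_seq F -> orthonormal alpha F id.
Proof.
have [BF Bo _] := basisB; move=> [uF FB]; split => //.
- by move=> b /FB /BF [].
- by move=> b c /FB Bb /FB Bc; exact: Bo.
Qed.

Lemma basis_seqU F G : basis_seq F -> basis_seq G -> basis_seq (undup (F ++ G)).
Proof.
move=> [uF FB] [uG GB]; split; first exact: undup_uniq.
by move=> b; rewrite mem_undup mem_cat => /orP[/FB|/GB].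
Qed.

(** For [F] inside [G], the Fourier sum over [F] is also that of the Fourier sum over [G], because
    the coefficients agree. *)
Lemma nsq_fourierB F G e : fock alpha e -> basis_seq F -> basis_seq G ->
  {subset F <= G} ->
  nsq (fun z => fourier alpha G id e z - fourier alpha F id e z) =
  \sum_(b <- G) normc (inner e b) ^+ 2 - \sum_(b <- F) normc (inner e b) ^+ 2.
Proof.
move=> [_ Le] bF bG FG.
have oF := basis_seq_orthonormal bF; have oG := basis_seq_orthonormal bG.
have LG := L2_fourier alpha0 e oG.
have E : {in F, forall b, inner (fourier alpha G id e) b = inner e b}.
  by move=> b /FG bGm; exact: (inner_fourier alpha0 e oG bGm).
have EF : fourier alpha F id e = fourier alpha F id (fourier alpha G id e).
  by apply/funext => z; apply: eq_big_seq => b bFm; rewrite E.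
rewrite EF nsq_sub_fourier// (nsq_fourier alpha0 oG Le).2.
by congr (_ - _); apply: eq_big_seq => b bFm; rewrite E.
Qed.

(** Fourier sums with nearly maximal coefficient sum converge to some [s] in [L2]. Maximality of [B]
    speaks only of the Fock space, so it is applied to [e - P s] and yields [e = P s]. *)
Lemma basis_approximation e (delta : R) : fock alpha e -> 0 < delta ->
  exists2 F, basis_seq F & nsq (fun z => e z - fourier alpha F id e z) <= delta.
Proof.
move=> Fe delta0; have [_ Le] := Fe; have [BF Bo Bmax] := basisB.
pose S F := \sum_(b <- F) normc (inner e b) ^+ 2.
pose X := [set x | exists2 F, basis_seq F & x = S F].
have bnil : basis_seq [::] by split.
have supX : has_sup X.
  split; first by exists (S [::]); exists [::].
  by exists (nsq e) => _ [F bF ->]; exact: (bessel alpha0 (basis_seq_orthonormal bF)).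
have S_le F : basis_seq F -> S F <= sup X.
  by move=> bF; apply: sup_upper_bound => //; exists F.
have /choice[F FP] : forall n : nat, exists F, basis_seq F /\ sup X - (16 ^+ n)^-1 < S F.
  move=> n; have e0 : 0 < (16 ^+ n)^-1 :> R by rewrite invr_gt0 exprn_gt0.
  by have [_ [F bF ->] ltF] := sup_adherent e0 supX; exists F.
pose f n := fourier alpha (F n) id e.
have bF n : basis_seq (F n) := (FP n).1.
have Ff n : fock alpha (f n).
  by apply: fock_lincomb => // b /(bF n).2; exact: BF.
have Lf n : L2 alpha (f n) := (Ff n).2.
have [s Ls fs] : exists2 s, L2 alpha s &
    forall n, (sqnorm alpha (fun z => f n z - s z)%R <= (4 * 2 / 16 ^+ n)%:E)%E.
  apply: fock_L2_complete => // n m.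
  rewrite (sqnorm_nsq alpha0 (L2_B alpha0 (Lf n) (Lf m))) lee_fin.
  (* The sets [F n] need not be nested, so the two sums are compared with the one over their union,
     whose coefficient sum is still at most [sup X]. *)
  have bU := basis_seqU (bF n) (bF m).
  set U := undup _ in bU.
  have LU := L2_fourier alpha0 e (basis_seq_orthonormal bU).
  apply: (le_trans (nsqB_le alpha0 (Lf n) (Lf m) LU)).
  have sub1 : {subset F n <= U} by move=> b; rewrite mem_undup mem_cat => ->.
  have sub2 : {subset F m <= U} by move=> b; rewrite mem_undup mem_cat orbC => ->.
  rewrite !nsq_fourierB// -/(S _) -/(S (F n)) -/(S (F m)).
  have := S_le _ bU; have := (FP n).2; have := (FP m).2; lra.
have nfs n : nsq (fun z => f n z - s z) <= 8 / 16 ^+ n.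
  have := fs n; rewrite (sqnorm_nsq alpha0 (L2_B alpha0 (Lf n) Ls)) lee_fin; lra.
have orth_es b : B b -> inner (fun z => e z - s z) b = 0.
  move=> Bb; have [_ Lb] := BF _ Bb.
  have b1 : inner b b = 1 by rewrite Bo// eqxx.
  (* If [b] is in [F n], the coefficient of [e - f n] vanishes; otherwise adding [b] to [F n] raises
     the coefficient sum by [|<e, b>|^2], which is bounded by the gap to the supremum. *)
  have h1 n : normc (inner (fun z => e z - f n z) b) ^+ 2 <= 1 / 16 ^+ n.
    have on := basis_seq_orthonormal (bF n).
    rewrite innerBl//; have [bn|bn] := boolP (b \in F n).
      rewrite (inner_fourier alpha0 e on bn) subrr sqr_normc /= expr0n addr0.
      by rewrite divr_ge0// exprn_ge0.
    have -> : inner (f n) b = 0.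
      have [_ Lon _] := on.
      rewrite (inner_lincombl alpha0 _ Lon Lb) big_seq_cond big1// => c /andP[cn _].
      have cb : c != b by apply: contraNneq bn => <-.
      by rewrite (Bo c b)// ?(negbTE cb) ?mulr0//; exact: (bF n).2.
    have bb : basis_seq (b :: F n).
      split; first by rewrite /= bn (bF n).1.
      by move=> c; rewrite inE => /orP[/eqP->//|/(bF n).2].
    have := S_le _ bb; rewrite /S big_cons -/(S (F n)) subr0.
    have := (FP n).2; lra.
  (* [18 = 2 * (1 + 8)], from [|x + y|^2 <= 2 |x|^2 + 2 |y|^2]. *)
  have bound n : normc (inner (fun z => e z - s z) b) ^+ 2 <= 18 / 16 ^+ n.
    have -> : inner (fun z => e z - s z) b =
        inner (fun z => e z - f n z) b + inner (fun z => f n z - s z) b.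
      by rewrite !innerBl//; ring.
    have h2 := normc_inner_le alpha0 (L2_B alpha0 (Lf n) Ls) Lb b1.
    have {}h2 := le_trans h2 (nfs n); have := h1 n; move: h2.
    set x := inner (fun z => e z - f n z) b; set y := inner _ b.
    rewrite !sqr_normc ReD ImD.
    have := sqr_ge0 (Re x - Re y); have := sqr_ge0 (Im x - Im y); nra.
  have := le0_geometric_bound bound; rewrite sqr_normc.
  set x := inner _ b => x0; have := sqr_ge0 (Re x); have := sqr_ge0 (Im x) => i0 r0.
  apply: complex_eq; apply/eqP; rewrite -sqrf_eq0 eq_le sqr_ge0 andbT; lra.
have [FPs orthP] := projP Ls; have [_ LPs] := FPs.
have ePs : (fun z => e z - P s z) = (fun=> 0).
  apply: Bmax; first exact: fock_B.
  move=> b Bb; have [_ Lb] := BF _ Bb.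
  have := orth_es b Bb; have := orthP b (BF _ Bb).
  rewrite !innerBl// => /eqP; rewrite subr_eq0 => /eqP <-.
  by [].
have eE z : e z = P s z by apply/eqP; rewrite -subr_eq0; apply/eqP; exact: (congr1 (@^~ z) ePs).
(* As [e = P s], the vector [f n - s] is the sum of [f n - e], in the Fock space, and [P s - s],
   orthogonal to it; hence [f n] is at least as close to [e] as to [s]. *)
have close n : nsq (fun z => e z - f n z) <= 8 / 16 ^+ n.
  apply: le_trans (nfs n).
  have Len := L2_B alpha0 Le (Lf n); have LsP := L2_B alpha0 Ls LPs.
  have E : (fun z => f n z - s z) =
      (fun z => - 1 * ((e z - f n z) - (- 1 * (s z - P s z)))).
    by apply/funext => z; rewrite eE; ring.
  have LsP' := L2_Z alpha0 (-1) LsP.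
  rewrite E (nsqZ alpha0); last by apply: L2_B.
  have -> : normc (- 1 : R[i]) ^+ 2 = 1 by rewrite sqr_normc /=; ring.
  rewrite mul1r (nsq_pythagoras alpha0 Len LsP'); first by rewrite lerDl nsq_ge0.
  rewrite (inner_conj alpha0 LsP' Len) innerZl// orthP ?mulr0 ?conjc0//.
  by apply: fock_B.
have [n hn] : exists n : nat, 8 / 16 ^+ n <= delta.
  apply: contrapT => /forallNP hn.
  have : delta <= 0.
    apply: (@le0_geometric_bound _ _ 8) => n.
    by have /negP := hn n; rewrite -ltNge => /ltW.
  by rewrite leNgt delta0.
by exists (F n) => //; exact: le_trans (close n) hn.
Qed.
End basis_approximation.

(** * Existence of an orthonormal basis *)

Section fock_basis.
Context {R : realType}.
Local Notation area := (@lebesgue_measure R \x @lebesgue_measure R)%E.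
Local Notation normc := ComplexField.Normc.normc.
Local Notation Re := complex.Re.
Local Notation Im := complex.Im.
Variable alpha : R.
Hypothesis alpha0 : 0 < alpha.
Local Notation nsq := (nsq alpha).
Local Notation inner := (inner alpha).

(** A square is used rather than a disc because its area is a product of interval lengths. *)
Lemma entire_neq0_square (f : R[i] -> R[i]) (w : R[i]) : entire f -> f w != 0 ->
  exists2 r : R, 0 < r & forall p : R * R,
    `|p.1 - Re w| < r -> `|p.2 - Im w| < r -> f (cxy p) != 0.
Proof.
move=> ef fw.
have cf : {for (w : R[i]^o), continuous (f : R[i]^o -> R[i]^o)}.
  by apply: differentiable_continuous; apply/derivable1_diffP; exact: ef.
have fw0 : 0 < `|f w : R[i]^o| by rewrite normr_gt0.
have /cf/nbhs_ballP[e /= e0 he] : nbhs (f w : R[i]^o) [set y : R[i]^o | y != 0].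
  apply: filterS (nbhsx_ballx (f w : R[i]^o) _ fw0) => y hy.
  by apply/eqP => y0; move: hy; rewrite y0 -ball_normE /ball_ /= subr0 ltxx.
(* Radii of balls in [R[i]] are themselves complex numbers; positivity makes [e] real. The half-side
   [Re e / 2] keeps the square inside the ball. *)
have er : 0 < Re e by move: e0; rewrite ltcE /= => /andP[].
have eI : Im e = 0 by move: e0; rewrite ltcE /= => /andP[/eqP].
exists (Re e / 2); first by rewrite divr_gt0.
move=> p h1 h2; apply: he; rewrite -ball_normE /ball_ /=.
rewrite -[`|_|]/((normc (w - cxy p))%:C%C) ltcE /= eI eqxx /=.
rewrite -(@ltr_pXn2r _ 2) ?nnegrE ?normc_ge0 ?(ltW er)// sqr_normc ReD ImD ReN ImN /=.
rewrite distrC in h1; rewrite distrC in h2.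
rewrite -(real_normK (num_real (Re w - p.1))) -(real_normK (num_real (Im w - p.2))).
by have := normr_ge0 (Re w - p.1); have := normr_ge0 (Im w - p.2); nra.
Qed.

(** If [f w] is nonzero, so is [f] on a square of positive area, whereas a vanishing norm puts that
    square inside a null set. *)
Lemma fock_nsq_eq0 (f : R[i] -> R[i]) : fock alpha f -> nsq f = 0 -> f = (fun=> 0).
Proof.
move=> [ef Lf] f0; apply/funext => w; apply/eqP; apply/negPn/negP => fw.
have [r r0 hr] := entire_neq0_square ef fw.
have mint := measurable_sqnorm_integrand alpha0 Lf.1.
have : (\int[area]_p `|(normc (f (cxy p)) ^+ 2 * gauss_weight alpha (cxy p))%:E| = 0)%E.
  rewrite (_ : (\int[_]_p _)%E = sqnorm alpha f); first by rewrite sqnorm_nsq// f0.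
  by apply: eq_integral => p _; rewrite gee0_abs// lee_fin sqnorm_integrand_ge0.
have mint' := mint; move/measurable_EFinP in mint'.
move/(ae_eq_integral_abs area measurableT mint').1 => [N [mN N0 sub]].
pose Q : set (measurableTypeR R * measurableTypeR R) :=
  `](Re w - r), (Re w + r)[%classic `*` `](Im w - r), (Im w + r)[%classic.
have mQ : measurable Q by apply: measurableX; exact: measurable_itv.
have QN : Q `<=` N.
  move=> p [/= p1 p2]; apply: sub => /= /(_ I) /eqP; rewrite eqe mulf_eq0.
  rewrite (gt_eqF (gauss_weight_gt0 alpha0 _)) orbF sqrf_eq0 => /eqP E.
  have := sqr_normc (f (cxy p)); rewrite E expr0n /= => E2.
  have hp : f (cxy p) != 0.
    apply: hr; rewrite ltr_norml; move: p1 p2; rewrite !in_itv /= => /andP[??] /andP[??];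
    by apply/andP; split; lra.
  move/negP: hp; apply; apply/eqP; apply: complex_eq => /=; apply/eqP;
    rewrite -sqrf_eq0 eq_le sqr_ge0 andbT.
  - by have := sqr_ge0 (Im (f (cxy p))); lra.
  - by have := sqr_ge0 (Re (f (cxy p))); lra.
have mu_itv (x : R) : lebesgue_measure `]x - r, x + r[%classic = (2 * r)%:E.
  rewrite lebesgue_measure_itv /= lte_fin ifT -?EFinB; last by lra.
  by congr EFin; ring.
have areaQ : area Q = ((2 * r)%:E * (2 * r)%:E)%E.
  apply: etrans (congr2 (fun x y => x * y)%E (mu_itv (Re w)) (mu_itv (Im w))).
  by apply: product_measure1E; exact: measurable_itv.
have areaQN : (area Q <= area N)%E by apply: le_measure => //; rewrite inE.
have : ((2 * r)%:E * (2 * r)%:E <= 0 :> \bar R)%E.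
  by rewrite -areaQ -[leRHS]N0.
by rewrite -EFinM lee_fin leNgt mulr_gt0// mulr_gt0.
Qed.

(** Even for the zero operator, [hilbert_schmidt] asks for a basis. Zorn's lemma supplies a maximal
    orthonormal set; a nonzero [f] orthogonal to it could be normalised and adjoined. Completeness
    of the monomials, hence power series, is thereby avoided. *)
Lemma exists_fock_orthonormal_basis : exists B, fock_orthonormal_basis alpha B.
Proof.
pose ON (B : set (R[i] -> R[i])) := B `<=` fock alpha /\
  forall b c, B b -> B c -> inner b c = (b == c)%:R.
have [F FON Ftot|A [[AF Ao] Amax]] := @Zorn_bigcup _ ON.
  split; first by move=> b [X FX Xb]; exact: (FON X FX).1.
  move=> b c [X FX Xb] [Y FY Yc]; have [XY|YX] := Ftot X Y FX FY.
    by apply: (FON Y FY).2 => //; exact: XY.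
  by apply: (FON X FX).2 => //; exact: YX.
exists A; split => // f Ff fA; apply: contrapT => fn0.
have [_ Lf] := Ff.
have nf : 0 < nsq f.
  rewrite lt_neqAle nsq_ge0// andbT eq_sym; apply/eqP => f0.
  by apply: fn0; exact: fock_nsq_eq0.
pose k : R[i] := (Num.sqrt (nsq f))^-1%:C%C.
pose g z := k * f z.
have Fg : fock alpha g.
  rewrite (_ : g = (fun z => k * f z + 0)); last by apply/funext => z; rewrite addr0.
  by apply: fock_lin => //; exact: fock_0.
have [_ Lg] := Fg.
have g1 : inner g g = 1.
  rewrite inner_nsq// nsqZ// sqr_normc /= expr0n addr0 exprVn sqr_sqrtr ?ltW//.
  by rewrite mulVf// gt_eqF.
have gA b : A b -> inner g b = 0.
  by move=> Ab; rewrite innerZl//; [rewrite fA// mulr0|case: (AF b Ab)].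
have gnA : ~ A g by move=> /gA; rewrite g1 => /eqP; rewrite oner_eq0.
apply: (Amax (A `|` [set g])).
  by split; [move=> b Ab; left|move=> /(_ g (or_intror erefl))].
split; first by move=> b [/AF//|->].
move=> b c [Ab|->] [Ac|->].
- exact: Ao.
- have -> : (b == g) = false by apply/eqP => E; apply: gnA; rewrite -E.
  by rewrite (inner_conj alpha0 Lg (AF b Ab).2) gA// conjc0.
- have -> : (g == c) = false by apply/eqP => E; apply: gnA; rewrite E.
  exact: gA.
- by rewrite g1 eqxx.
Qed.
End fock_basis.

Lemma ler_sum_subseq (R : numDomainType) (I : eqType) (g : I -> R) (F G : seq I) :
  (forall b, 0 <= g b) -> uniq F -> uniq G -> {subset F <= G} ->
  \sum_(b <- F) g b <= \sum_(b <- G) g b.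
Proof.
move=> g0 uF uG FG.
have pFG : perm_eq F [seq b <- G | b \in F].
  apply: uniq_perm => //; first exact: filter_uniq.
  by move=> b; rewrite mem_filter; case: (boolP (b \in F)) => // /FG ->.
rewrite (perm_big _ pFG) /= big_filter big_mkcond /=.
by apply: ler_sum => b _; case: ifP.
Qed.

(** * Lower bound for the Hilbert-Schmidt sum *)

Section hilbert_schmidt_bound.
Context {R : realType}.
Local Notation normc := ComplexField.Normc.normc.
Local Notation Re := complex.Re.
Local Notation Im := complex.Im.
Variables (alpha : R) (K P : (R[i] -> R[i]) -> R[i] -> R[i]) (B : set (R[i] -> R[i])).
Hypothesis alpha0 : 0 < alpha.
Hypothesis dilK : dilation alpha K.
Hypothesis projP : fock_projection alpha P.
Hypothesis basisB : fock_orthonormal_basis alpha B.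
Local Notation inner := (inner alpha).
Local Notation nsq := (nsq alpha).
Local Notation e_ := (fock_monomial alpha).

Lemma L2_dilation f : fock alpha f -> L2 alpha (K f).
Proof. by case: dilK => + _ _ _ _; exact. Qed.

(** [K] respects linear combinations only almost everywhere, so its linearity is used after pairing
    with some [h]. *)
Lemma inner_dilation_lin (a : R[i]) f g h : fock alpha f -> fock alpha g -> L2 alpha h ->
  inner (K (fun z => a * f z + g z)) h = a * inner (K f) h + inner (K g) h.
Proof.
move=> Ff Fg Lh; have [_ Klin _ _ _] := dilK.
have LKf := L2_dilation Ff; have LKg := L2_dilation Fg.
rewrite (inner_ae alpha0 _ _ Lh (Klin a f g Ff Fg)) ?inner_linl//.
- by apply: L2_dilation; exact: fock_lin.
- exact: L2_lin.
Qed.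

Lemma inner_dilation_lincomb (s : seq (R[i] -> R[i])) (c : (R[i] -> R[i]) -> R[i]) h :
  {in s, forall b, fock alpha b} -> L2 alpha h ->
  inner (K (lincomb s c id)) h = \sum_(b <- s) c b * inner (K b) h.
Proof.
move=> + Lh; elim: s => [|b s IHs] Fs.
  rewrite big_nil.
  have E : lincomb [::] c id = (fun=> 0) by apply/funext => z; rewrite /lincomb big_nil.
  (* With [a = 1] and [f = g = 0], the pairing [x] of [K 0] with [h] satisfies [x = x + x]. *)
  have := inner_dilation_lin 1 (fock_0 alpha) (fock_0 alpha) Lh.
  under [X in K X]eq_fun do rewrite mulr0 addr0.
  rewrite E mul1r => /eqP; rewrite -subr_eq0 opprD addrA subrr sub0r oppr_eq0.
  by move=> /eqP.
have Fs' : {in s, forall b, fock alpha b}.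
  by move=> j js; apply: Fs; rewrite inE js orbT.
have Fb : fock alpha b by apply: Fs; rewrite inE eqxx.
have E : lincomb (b :: s) c id = (fun z => c b * b z + lincomb s c id z).
  by apply/funext => z; rewrite /lincomb big_cons.
by rewrite E inner_dilation_lin ?IHs ?big_cons//; exact: fock_lincomb.
Qed.

Lemma fourier_dilation_lower_bound (m : nat) : exists2 F, basis_seq B F &
  1 / 4 <= \sum_(b <- F) normc (inner (K b) (e_ m)) ^+ 2.
Proof.
have [_ Klin [M Kbound] Keven _] := dilK; have [BF _ _] := basisB.
have Fe k : fock alpha (e_ k) by exact: fock_fock_monomial.
have Le k : L2 alpha (e_ k) := (Fe k).2.
have ee k : inner (e_ k) (e_ k) = 1 by rewrite inner_fock_monomial// eqxx.
(* Chosen so that [M ^+ 2 * delta <= 1 / 4]; the [+ 1] guards against [M = 0]. *)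
pose delta := (4 * (M ^+ 2 + 1))^-1.
have M1 : 0 < 4 * (M ^+ 2 + 1) by rewrite mulr_gt0// ltr_wpDl// sqr_ge0.
have delta0 : 0 < delta by rewrite invr_gt0.
have [F bF Fdelta] := basis_approximation alpha0 projP basisB (Fe m.*2) delta0.
exists F => //; set e := e_ m.*2 in Fdelta *.
have oF := basis_seq_orthonormal basisB bF.
have FF : {in F, forall b, fock alpha b} by move=> b /bF.2; exact: BF.
pose sF := fourier alpha F id e.
have FsF : fock alpha sF by exact: fock_lincomb.
have Fd : fock alpha (fun z => e z - sF z) by apply: fock_B => //; exact: Fe.
have Ke : inner (K e) (e_ m) = 1.
  by rewrite (inner_ae alpha0 (L2_dilation (Fe _)) (Le m) (Le m) (Keven m)) ee.
have small : normc (inner (K (fun z => e z - sF z)) (e_ m)) ^+ 2 <= 1 / 4.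
  have LKd := L2_dilation Fd.
  apply: le_trans (normc_inner_le alpha0 LKd (Le m) (ee m)) _.
  have := Kbound _ Fd; rewrite (sqnorm_nsq alpha0 LKd) (sqnorm_nsq alpha0 Fd.2).
  rewrite -EFinM lee_fin => /le_trans; apply.
  apply: (@le_trans _ _ (M ^+ 2 * delta)); first by rewrite ler_wpM2l// sqr_ge0.
  rewrite /delta ler_pdivrMr// mulrA; have := sqr_ge0 M; lra.
have split_e : inner (K e) (e_ m) =
    inner (K sF) (e_ m) + inner (K (fun z => e z - sF z)) (e_ m).
  have E : e = (fun z => 1 * sF z + (e z - sF z)) by apply/funext => z; ring.
  by rewrite [in LHS]E (inner_dilation_lin 1 FsF Fd (Le m)) mul1r.
(* The two pairings [x] and [y] satisfy [x + y = 1] and [|y| <= 1 / 2]. *)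
have re_half : 1 / 2 <= Re (inner (K sF) (e_ m)).
  move: small split_e; rewrite Ke; set x := inner (K sF) _; set y := inner _ _.
  move=> + /(congr1 (@complex.Re R)); rewrite ReD sqr_normc /= => h1 h2.
  by have := sqr_ge0 (Im y); nra.
have expand : Re (inner (K sF) (e_ m)) =
    \sum_(b <- F) Re (inner e b * inner (K b) (e_ m)).
  rewrite inner_dilation_lincomb//.
  by elim/big_ind2 : _ => //= a b c d <- <-; rewrite ReD.
have e1 : \sum_(b <- F) normc (inner e b) ^+ 2 <= 1.
  apply: le_trans (bessel alpha0 oF (Fe _).2) _.
  by rewrite (_ : nsq e = 1)//; exact: (congr1 (@complex.Re R) (ee m.*2)).
(* The weight [1 / 4] lets the coefficients of [e], whose squares sum to at most 1, use up only half
   of the lower bound [1 / 2]. *)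
have amgm : Re (inner (K sF) (e_ m)) <=
    4^-1 * (\sum_(b <- F) normc (inner e b) ^+ 2)
    + \sum_(b <- F) normc (inner (K b) (e_ m)) ^+ 2.
  have per b : Re (inner e b * inner (K b) (e_ m)) <=
      4^-1 * normc (inner e b) ^+ 2 + normc (inner (K b) (e_ m)) ^+ 2.
    rewrite ReM !sqr_normc; set x := inner e b; set y := inner (K b) _.
    have := sqr_ge0 (Re x / 2 - Re y); have := sqr_ge0 (Im x / 2 + Im y); nra.
  by rewrite expand mulr_sumr -big_split; apply: ler_sum => b _; exact: per.
lra.
Qed.

(** One finite set for all [m < N] is what allows the sums over [b] and [m] to be exchanged;
    enlarging the set only increases sums of squares. *)
Lemma common_lower_bound (N : nat) : exists2 F, basis_seq B F &
  forall m, (m < N)%N -> 1 / 4 <= \sum_(b <- F) normc (inner (K b) (e_ m)) ^+ 2.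
Proof.
elim: N => [|N [F bF hF]]; first by exists [::].
have [G bG hG] := fourier_dilation_lower_bound N.
have bU := basis_seqU bF bG; exists (undup (F ++ G)) => // m.
rewrite ltnS leq_eqVlt => /orP[/eqP->|/hF h].
  apply: (le_trans hG); apply: ler_sum_subseq;
    [by move=> b; exact: sqr_ge0|exact: bG.1|exact: bU.1|].
  by move=> b bGm; rewrite mem_undup mem_cat bGm orbT.
apply: (le_trans h); apply: ler_sum_subseq;
  [by move=> b; exact: sqr_ge0|exact: bF.1|exact: bU.1|].
by move=> b bFm; rewrite mem_undup mem_cat bFm.
Qed.

(** As [e_m] lies in the Fock space, [P] does not change the pairing with it, so the coefficients of
    [P (c K b)] are [c] times those of [K b]. *)
Lemma toeplitz_constant_bessel (c : R[i]) (N : nat) b : B b ->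
  normc c ^+ 2 * \sum_(0 <= m < N) normc (inner (K b) (e_ m)) ^+ 2 <=
  nsq (P (fun z => c * K b z)).
Proof.
have [BF _ _] := basisB; move=> /BF Fb; have LKb := L2_dilation Fb.
have LcK := L2_Z alpha0 c LKb; have [[_ LT] orthT] := projP LcK.
have Fe k : fock alpha (e_ k) by exact: fock_fock_monomial.
have oe : orthonormal alpha (index_iota 0 N) e_.
  split; first exact: iota_uniq.
    by move=> k _; exact: (Fe k).2.
  by move=> k l _ _; rewrite inner_fock_monomial.
apply: le_trans (bessel alpha0 oe LT).
rewrite mulr_sumr; apply: ler_sum => m _.
rewrite -sqr_normcM -(innerZl alpha0 c LKb (Fe m).2).
have := orthT _ (Fe m); rewrite (innerBl alpha0 LcK LT (Fe m).2).
by move=> /eqP; rewrite subr_eq0 => /eqP ->.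
Qed.

Lemma hilbert_schmidt_constant (c : R[i]) :
  (\esum_(b in B) sqnorm alpha (P (fun z => (c * K b z)%R)) < +oo)%E -> c = 0.
Proof.
set H := (\esum_(b in B) _)%E => Hoo.
have H0 : (0 <= H)%E by apply: esum_ge0 => b _; exact: sqnorm_ge0.
have Hfin : H \is a fin_num by rewrite ge0_fin_numE.
have [BF _ _] := basisB.
have bound (N : nat) : N%:R * (normc c ^+ 2 / 4) <= fine H.
  have [F bF hF] := common_lower_bound N.
  apply: (@le_trans _ _ (\sum_(b <- F) nsq (P (fun z => c * K b z)))).
    apply: (@le_trans _ _ (\sum_(b <- F)
        normc c ^+ 2 * \sum_(0 <= m < N) normc (inner (K b) (e_ m)) ^+ 2)).
      rewrite -mulr_sumr exchange_big mulrCA; apply: ler_wpM2l; first exact: sqr_ge0.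
      rewrite (_ : N%:R * 4^-1 = \sum_(0 <= m < N) (1 / 4)); last first.
        by rewrite sumr_const_nat subn0 -[RHS]mulr_natl div1r.
      by apply: ler_sum_nat => m /andP[_ mN]; exact: hF.
    rewrite big_seq [leRHS]big_seq; apply: ler_sum => b /bF.2.
    exact: toeplitz_constant_bessel.
  rewrite -lee_fin fineK// -sumEFin.
  rewrite (eq_big_seq (fun b => sqnorm alpha (P (fun z => c * K b z)))); last first.
    move=> b /bF.2 /BF Fb; rewrite sqnorm_nsq//.
    by have [[]] := projP (L2_Z alpha0 c (L2_dilation Fb)).
  apply: ereal_sup_ubound; exists [set` F].
    by split; [exact: finite_seq|move=> b /= /bF.2].
  by rewrite -fsbig_seq//; exact: bF.1.
have c0 : normc c ^+ 2 <= 0.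
  rewrite leNgt; apply/negP => cpos.
  have c4 : 0 < normc c ^+ 2 / 4 by rewrite divr_gt0.
  have h0 : 0 <= fine H / (normc c ^+ 2 / 4) by rewrite divr_ge0 ?fine_ge0// ltW.
  have := archi_boundP h0; set n := Num.bound _.
  by rewrite ltr_pdivrMr// ltNge bound.
move: c0; rewrite sqr_normc => c0.
have r0 := sqr_ge0 (Re c); have i0 := sqr_ge0 (Im c).
by apply: complex_eq; apply/eqP; rewrite -sqrf_eq0 eq_le sqr_ge0 andbT; lra.
Qed.
End hilbert_schmidt_bound.

Lemma bounded_harmonic_on_C_constant (R : realType) (phi : R[i] -> R[i]) :
  harmonic_on_C phi -> bounded_on_C phi -> forall z, phi z = phi 0.
Proof.
move=> [hr hi] [M phiM] z.
have M0 : 0 <= M by apply: le_trans (phiM 0); exact: normc_ge0.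
have ReM p : `|complex.Re (phi (cxy p))| <= M.
  apply: le_trans (phiM (cxy p)).
  rewrite -(@ler_pXn2r _ 2) ?nnegrE ?normc_ge0// real_normK ?num_real// sqr_normc.
  by rewrite lerDl sqr_ge0.
have ImM p : `|complex.Im (phi (cxy p))| <= M.
  apply: le_trans (phiM (cxy p)).
  rewrite -(@ler_pXn2r _ 2) ?nnegrE ?normc_ge0// real_normK ?num_real// sqr_normc.
  by rewrite lerDr sqr_ge0.
case: z => x y; apply: complex_eq.
- exact: (bounded_harmonic_constant hr ReM (x, y) (0, 0)).
- exact: (bounded_harmonic_constant hi ImM (x, y) (0, 0)).
Qed.

Theorem theorem12 (R : realType) (alpha : R)
    (K P : (R[i] -> R[i]) -> R[i] -> R[i]) (phi : R[i] -> R[i]) :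
  0 < alpha -> dilation alpha K -> fock_projection alpha P ->
  harmonic_on_C phi -> bounded_on_C phi ->
  hilbert_schmidt alpha (h_toeplitz K P phi) <-> (forall z, phi z = 0).
Proof.
move=> alpha0 dilK projP hphi bphi; split.
  move=> [B basisB HS] z.
  have cphi := bounded_harmonic_on_C_constant hphi bphi.
  rewrite cphi; apply: (hilbert_schmidt_constant alpha0 dilK projP basisB).
  move: HS; rewrite /h_toeplitz; congr (_ < _)%E.
  apply: eq_esum => b _; congr (sqnorm alpha (P _)).
  by apply/funext => w; rewrite cphi.
move=> phi0; have [B basisB] := exists_fock_orthonormal_basis alpha0.
exists B => //; rewrite esum1 ?ltry// => b _.
rewrite /h_toeplitz (_ : (fun z => _) = (fun=> 0)); last first.
  by apply/funext => z; rewrite phi0 mul0r.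
(* [P] is known only through its defining property; for the zero function, tested against [P 0]
   itself, it says that [P 0] has norm 0. *)
have [FP0 orthP] := projP _ (L2_0 alpha).
have [_ LP0] := FP0.
rewrite sqnorm_nsq//; congr EFin.
have := orthP _ FP0; rewrite (innerBl alpha0 (L2_0 alpha) LP0 LP0) inner0l sub0r.
by rewrite (inner_nsq alpha0 LP0) => /eqP; rewrite oppr_eq0 => /eqP [].
Qed.
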